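(* Let $$\mathcal N(x)=\sum_{k\ge1}x^kq^{-\binom k2}\frac{(-q^2;q^2)_{k-1}}{1-q^k},\qquad \mathcal S(x)=\sum_{k\ge1}x^kq^{-\binom{k+1}2}(-q^2;q^2)_{k-1},$$ so that $\mathcal S(x)=\mathcal N(x/q)-\mathcal N(x)$. Then $$\mathcal B^{(a)}(x)=1+\mathcal S(xq)+\mathcal S(xq^2)-x\big(\mathcal S(x)-\mathcal S(xq)\big)\mathcal A(x),$$ $$\mathcal L(x)=\mathcal N(x)-x\big(\mathcal S(x)-\mathcal S(xq)\big)\mathcal B^{(a)}(x).$$
   Context: A heap over the $n$-point path ($n\ge1$) is an equivalence class of finite words on $\{1,\dots,n\}$ under exchanges of adjacent letters $i,j$ with $|i-j|\ge2$; size $|H|$ = length of a representative; the number of points in column $i$ is the number of occurrences of $i$ (column $n$ is the last column). It is alternating if for each $i\in\{1,\dots,n-1\}$ the occurrences of $i$ and $i+1$ alternate in a (equivalently any) representative, and self-dual if the reversal of a representative lies in the same class. The empty path ($n=0$) carries only the empty heap. $\mathcal B^{(a)}(x)=\sum_{n\ge0}x^n\sum_Hq^{|H|}$ over self-dual alternating heaps over the $n$-point path with at most one point in the last column ($n=0$ term $1$); $\mathcal L(x)=\sum_{n\ge1}x^n\sum_Hq^{|H|}$ over all self-dual alternating heaps over the $n$-point path. $\mathcal A(x)=\sum_{n\ge0}\mathcal A_n^{FC}(q)x^n$, where $\mathcal A_n^{FC}(q)$ is the Coxeter-length generating function of fully commutative involutions ($w^2=1$, identity included; fully commutative meaning any two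 reduced expressions are related by commutation relations only) of the type-$A_n$ Coxeter group (symmetric group on $n+1$ letters, $A_0$ trivial). $(a;q^2)_n=(1-a)(1-aq^2)\cdots(1-aq^{2n-2})$. *)

(* Defs.v *)
From HB Require Import structures.
From mathcomp Require Import all_boot all_order all_fingroup all_algebra.
From mathcomp Require Import boolp.

Set Implicit Arguments.
Unset Strict Implicit.
Unset Printing Implicit Defensive.

Import GRing.Theory.
Local Open Scope ring_scope.

(** * Formal power series *)

Record fps (R : Type) := Fps { fcoef : nat -> R }.

HB.instance Definition _ (R : Type) := gen_eqMixin (fps R).
HB.instance Definition _ (R : Type) := gen_choiceMixin (fps R).

Lemma fpsP (R : Type) (f g : fps R) : fcoef f =1 fcoef g <-> f = g.
Proof.
by case: f g => [f] [g]; split=> /= [/funext -> // | [->]].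
Qed.

Section FpsZmod.
Variable R : nzRingType.
Implicit Types f g h : fps R.

Definition fps0 : fps R := Fps (fun _ => 0).
Definition fps_opp f := Fps (fun n => - fcoef f n).
Definition fps_add f g := Fps (fun n => fcoef f n + fcoef g n).

Lemma fps_addA : associative fps_add.
Proof. by move=> f g h; apply/fpsP=> n /=; rewrite addrA. Qed.
Lemma fps_addC : commutative fps_add.
Proof. by move=> f g; apply/fpsP=> n /=; rewrite addrC. Qed.
Lemma fps_add0 : left_id fps0 fps_add.
Proof. by move=> f; apply/fpsP=> n /=; rewrite add0r. Qed.
Lemma fps_addN : left_inverse fps0 fps_opp fps_add.
Proof. by move=> f; apply/fpsP=> n /=; rewrite addNr. Qed.

HB.instance Definition _ :=
  GRing.isZmodule.Build (fps R) fps_addA fps_addC fps_add0 fps_addN.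

End FpsZmod.

Section FpsRing.
Variable R : comNzRingType.
Implicit Types f g h : fps R.

Definition fps1 : fps R := Fps (fun n => (n == 0%N)%:R).
Definition fps_mul f g :=
  Fps (fun n => \sum_(i < n.+1) fcoef f i * fcoef g (n - i)).

Definition fps_trunc n f : {poly R} := \poly_(i < n) fcoef f i.

Lemma fps_mul_poly n f g (p r : {poly R}) :
    (forall i, (i <= n)%N -> p`_i = fcoef f i) ->
    (forall i, (i <= n)%N -> r`_i = fcoef g i) ->
  fcoef (fps_mul f g) n = (p * r)`_n.
Proof.
move=> pE rE; rewrite coefM /=; apply: eq_bigr => i _.
by rewrite pE ?rE ?leq_subr // -ltnS.
Qed.

Lemma fps_truncE n m f i : (i <= n)%N -> (n < m)%N ->
  (fps_trunc m f)`_i = fcoef f i.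
Proof. by move=> le_in lt_nm; rewrite coef_poly (leq_ltn_trans le_in). Qed.

Lemma fps_mul_trunc n m f g : (n < m)%N ->
  fcoef (fps_mul f g) n = (fps_trunc m f * fps_trunc m g)`_n.
Proof. by move=> nm; apply: fps_mul_poly => i le_in; apply: (@fps_truncE n). Qed.

Lemma fps_mulA : associative fps_mul.
Proof.
move=> f g h; apply/fpsP=> n; set t := fps_trunc n.+1.
rewrite (@fps_mul_poly n f (fps_mul g h) (t f) (t g * t h)).
- rewrite (@fps_mul_poly n (fps_mul f g) h (t f * t g) (t h)) ?mulrA // => i le_in.
    by rewrite (@fps_mul_trunc i n.+1).
  exact: (@fps_truncE n).
- by move=> i le_in; apply: (@fps_truncE n).
by move=> i le_in; rewrite (@fps_mul_trunc i n.+1).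
Qed.

Lemma fps_mulC : commutative fps_mul.
Proof.
by move=> f g; apply/fpsP=> n; rewrite !(@fps_mul_trunc n n.+1) // mulrC.
Qed.

Lemma fps_mul1 : left_id fps1 fps_mul.
Proof.
move=> f; apply/fpsP=> n /=; rewrite big_ord_recl /= mul1r subn0.
by rewrite big1 ?addr0 // => i _; rewrite mul0r.
Qed.

Lemma fps_mulDl : left_distributive fps_mul (@fps_add R).
Proof.
move=> f g h; apply/fpsP=> n /=; rewrite -big_split /=.
by apply: eq_bigr => i _; rewrite mulrDl.
Qed.

Lemma fps1_neq0 : fps1 != 0 :> fps R.
Proof.
apply/eqP=> /fpsP/(_ 0%N) /eqP; by rewrite /= oner_eq0.
Qed.

HB.instance Definition _ :=
  GRing.Zmodule_isComNzRing.Build (fps R)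
    fps_mulA fps_mulC fps_mul1 fps_mulDl fps1_neq0.

Definition fps_unit : {pred fps R} := fun f => `[< exists g, g * f = 1 >].

Definition fps_inv f : fps R :=
  if pselect (exists g, g * f = 1) is left e then projT1 (cid e) else f.

Lemma fps_mulV : {in fps_unit, left_inverse 1 fps_inv *%R}.
Proof.
move=> f; rewrite -topredE /= => /asboolP fU; rewrite /fps_inv.
by case: pselect => // e; case: cid.
Qed.

Lemma fps_unitP f g : g * f = 1 -> fps_unit f.
Proof. by move=> gf; apply/asboolP; exists g. Qed.

Lemma fps_inv_out : {in [predC fps_unit], fps_inv =1 id}.
Proof.
move=> f; rewrite inE /= -topredE /= => /negP fNU; rewrite /fps_inv.
by case: pselect => // e; case: fNU; apply/asboolP.
Qed.

HB.instance Definition _ :=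
  GRing.ComNzRing_hasMulInverse.Build (fps R) fps_mulV fps_unitP fps_inv_out.

Definition fpsX : fps R := Fps (fun n => (n == 1%N)%:R).

(* The substitution f(x) |-> f(a x). *)
Definition fps_dil (a : R) f : fps R := Fps (fun n => a ^+ n * fcoef f n).

End FpsRing.

Arguments fpsX {R}.

Section FpsIdomain.
Variable R : idomainType.

Lemma fps_order (f : fps R) : f != 0 ->
  exists n, fcoef f n != 0 /\ forall i, (i < n)%N -> fcoef f i = 0.
Proof.
move=> f_neq0; have ex_n : exists n, fcoef f n != 0.
  apply: contrapT => noex; case/eqP: f_neq0; apply/fpsP=> n /=.
  by apply/eqP/negPn/negP=> fn; apply: noex; exists n.
case: (ex_minnP ex_n) => n fn min_n; exists n; split=> // i lt_in.
by apply/eqP/negPn/negP=> /min_n; rewrite leqNgt lt_in.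
Qed.

Lemma fps_integral : GRing.integral_domain_axiom (fps R).
Proof.
move=> f g fg0; apply/norP=> -[/fps_order[m [fm f_lt]] /fps_order[n [gn g_lt]]].
have /eqP := congr1 (fun h => fcoef h (m + n)) fg0; apply/negP => /=.
have lt_m : (m < (m + n).+1)%N by rewrite ltnS leq_addr.
rewrite (bigD1 (Ordinal lt_m)) //= big1 ?addr0 => [|i ne_im].
  by rewrite addKn mulf_neq0.
have [lt_im | le_mi] := ltnP i m; first by rewrite f_lt ?mul0r.
have lt_mi : (m < i)%N.
  move: le_mi; rewrite leq_eqVlt => /predU1P[e | //].
  by case/eqP: ne_im; apply: val_inj.
rewrite [fcoef g _]g_lt ?mulr0 // ltn_subLR ?ltn_add2r //.
by rewrite -ltnS ltn_ord.
Qed.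

HB.instance Definition _ :=
  GRing.ComUnitRing_isIntegral.Build (fps R) fps_integral.

End FpsIdomain.

(* The fraction field of Q[[q]] is the field Q((q)) of formal Laurent series;
   the series in x below have their coefficients in it. *)
Definition laurent : fieldType := {fraction (fps rat)}.
Definition q : laurent := tofrac (fpsX : fps rat).

Definition qpoch (K : comNzRingType) (a p : K) (n : nat) : K :=
  \prod_(i < n) (1 - a * p ^+ i).

(** * Heaps over a path *)

(* The n points of the path are the elements of 'I_n: the ordinal i stands for
   the letter i + 1. *)
Section Heaps.
Variable n : nat.

Definition far (i j : 'I_n) : bool := (i.+1 < j)%N || (j.+1 < i)%N.

Section Size.
Variable m : nat.
Implicit Types (w : m.-tuple 'I_n) (H : {set m.-tuple 'I_n}).

Definition comm_step w w' : bool :=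
  `[< exists (u v : seq 'I_n) (i j : 'I_n),
        [/\ far i j, tval w = u ++ [:: i, j & v]
          & tval w' = u ++ [:: j, i & v]] >].

(* As comm_step is symmetric, connect is the equivalence it generates. *)
Definition comm_equiv : rel (m.-tuple 'I_n) := connect comm_step.

(* Commutations preserve the length, so the heaps of size m are the classes of
   the words of length m. *)
Definition heaps : {set {set m.-tuple 'I_n}} :=
  equivalence_partition comm_equiv [set: m.-tuple 'I_n].

Definition alternating_word w : bool :=
  [forall i : 'I_n, forall j : 'I_n, (j == i.+1 :> nat) ==>
     sorted [rel a b | a != b] [seq a <- w | (a == i) || (a == j)]].

Definition alternating H : bool := [exists w in H, alternating_word w].

Definition self_dual H : bool := [exists w in H, [tuple of rev w] \in H].

Definition last_le1 H : bool :=
  [exists w in H, count (fun i : 'I_n => i.+1 == n) w <= 1]%N.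

End Size.

Definition sd_alt_gf : fps rat :=
  Fps (fun m => #|[set H in heaps m | alternating H && self_dual H]|%:R).

Definition sd_alt_last_gf : fps rat :=
  Fps (fun m =>
    #|[set H in heaps m | [&& alternating H, self_dual H & last_le1 H]]|%:R).

End Heaps.

(** * Fully commutative involutions in type A *)

Section TypeA.
Variable n : nat.
Implicit Types s : {perm 'I_n.+1}.

Definition sgen (i : 'I_n) : {perm 'I_n.+1} :=
  tperm (widen_ord (leqnSn n) i) (lift ord0 i).

Definition wprod (w : seq 'I_n) : {perm 'I_n.+1} := (\prod_(i <- w) sgen i)%g.

Lemma wprod_tperm (i j : 'I_n.+1) : exists w, wprod w = tperm i j.
Proof.
wlog le_ij : i j / (i <= j)%N.
  move=> IH; case: (leqP i j) => [|/ltnW]; first exact: IH.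
  by rewrite tpermC; apply: IH.
case: j le_ij; elim=> [|j IHj] lt_j le_ij.
  exists [::]; rewrite /wprod big_nil -[LHS](tperm1 i); congr tperm.
  by apply: val_inj => /=; move: le_ij; case: (i : nat).
have [eq_ij | ne_ij] := eqVneq (i : nat) j.+1.
  exists [::]; rewrite /wprod big_nil -[LHS](tperm1 i); congr tperm.
  exact: val_inj.
have lt_ij : (i <= j)%N by rewrite -ltnS ltn_neqAle ne_ij.
have lt_j' : (j < n.+1)%N by apply: ltnW.
have [w Ew] := IHj lt_j' lt_ij; pose k := Ordinal (lt_j : (j < n)%N).
have sgE : sgen k = tperm (Ordinal lt_j') (Ordinal lt_j).
  by congr tperm; apply: val_inj.
have [eq_ij | ne_ij'] := eqVneq i (Ordinal lt_j').
  by exists [:: k]; rewrite /wprod big_seq1 sgE eq_ij.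
exists (k :: w ++ [:: k]); rewrite /wprod big_cons big_cat big_seq1 -/(wprod w).
have -> : (sgen k * (wprod w * sgen k))%g = (wprod w ^ sgen k)%g.
  by rewrite /conjg sgE tpermV.
rewrite Ew tpermJ sgE tpermL tpermD //; first by rewrite eq_sym.
by rewrite eq_sym -val_eqE.
Qed.

Lemma wprod_surj s :
  exists m, [exists w : m.-tuple 'I_n, wprod w == s].
Proof.
have [w <-] : exists w, wprod w = s.
  have [ts -> _] := prod_tpermP s; elim: ts => [|t ts [w Ew]].
    by exists [::]; rewrite /wprod !big_nil.
  have [w' Ew'] := wprod_tperm t.1 t.2.
  by exists (w' ++ w); rewrite /wprod big_cat big_cons -Ew -Ew'.
by exists (size w); apply/existsP; exists (in_tuple w).
Qed.

Definition coxlen s : nat := ex_minn (wprod_surj s).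

(* The reduced expressions of s are its expressions of length coxlen s. *)
Definition fully_commutative s : bool :=
  [forall w : (coxlen s).-tuple 'I_n, forall w' : (coxlen s).-tuple 'I_n,
     (wprod w == s) && (wprod w' == s) ==> comm_equiv w w'].

Definition fc_invol_gf : laurent :=
  \sum_(s : {perm 'I_n.+1} | fully_commutative s && (s * s == 1)%g)
     q ^+ coxlen s.

End TypeA.

(** * The series in x *)

Definition calA : fps laurent := Fps (fun n => fc_invol_gf n).

Definition calBa : fps laurent := Fps (fun n => tofrac (sd_alt_last_gf n)).

Definition calL : fps laurent :=
  Fps (fun n => if n == 0%N then 0 else tofrac (sd_alt_gf n)).

Definition calN : fps laurent :=
  Fps (fun k => if k == 0%N then 0 else
    q ^- 'C(k, 2) * (qpoch (- q ^+ 2) (q ^+ 2) k.-1 / (1 - q ^+ k))).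

Definition calS : fps laurent :=
  Fps (fun k => if k == 0%N then 0 else
    q ^- 'C(k.+1, 2) * qpoch (- q ^+ 2) (q ^+ 2) k.-1).

(* Main.v *)
Require Import Defs.
From mathcomp Require Import all_boot all_order all_fingroup all_algebra.
From mathcomp Require Import boolp.
From mathcomp Require Import zify ring.

Set Implicit Arguments.
Unset Strict Implicit.
Unset Printing Implicit Defensive.

(** A self-dual alternating heap is determined by its column sizes
    [a_1, ..., a_n], which may be any sequence of naturals in which consecutive
    terms differ by one or are both zero: alternation and symmetry force the
    letters [i] and [i + 1] to form an odd alternating palindrome. So [L]
    counts by area the walks with steps [+1], [-1], and [0] at height [0]; for
    [B^(a)] the walk ends at height at most one.

    In a word that alternates on all pairs of adjacent columns and uses each
    end column at most once, a strand keeps moving in the direction of its first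
    move. Hence the left descents of the product are exactly the letters that
    can be commuted to the front, so the word is reduced and its product is
    fully commutative. Conversely a reduced word of a fully commutative element
    has this shape. So [A] counts the walks with both ends at height at most one.

    Let [G_h] be the series of walks starting at [h]; it satisfies
    [G_h = x q^h (e_h + G_(h+1) + G_(h-1))], with [G_0] in place of [G_(-1)],
    where [e_h] tells which end heights are allowed. Without the barrier at [0]
    the same equation with [e = 1] has the solution [d_h = S(x q^(h+1))] for all
    integers [h]. Pairing the two systems, everything telescopes except the
    boundary term [(d_(-1) - d_0) G_0], and [G_0 = x B^(a)] or [x A]. *)

(** * Commutation classes of words *)

Lemma split_first (T : eqType) (a : T) w : a \in w ->
  exists u z, w = u ++ a :: z /\ a \notin u.
Proof.
elim: w => // k v IHv; have [-> _ | ne] := eqVneq k a; first by exists [::], v.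
rewrite inE eq_sym (negPf ne) => /IHv[u [z [-> iu]]].
by exists (k :: u), z; rewrite inE eq_sym (negPf ne).
Qed.

Section Words.
Variable n : nat.
Implicit Types (i j k : 'I_n) (u v w z : seq 'I_n).

(** Commutation equivalence for words of any length, as a chain of swaps applied to the left word;
    symmetry then follows from that of [far]. *)
Inductive ceq : seq 'I_n -> seq 'I_n -> Prop :=
| ceq_refl w : ceq w w
| ceq_swap u v i j w :
    far i j -> ceq (u ++ [:: j, i & v]) w -> ceq (u ++ [:: i, j & v]) w.

Lemma far_sym i j : far i j = far j i.
Proof. by rewrite /far orbC. Qed.

Lemma ceq_trans w2 w1 w3 : ceq w1 w2 -> ceq w2 w3 -> ceq w1 w3.
Proof. by elim=> // u v i j w Fij _ IH /IH; apply: ceq_swap. Qed.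

Lemma ceq_swap1 u v i j :
  far i j -> ceq (u ++ [:: i, j & v]) (u ++ [:: j, i & v]).
Proof. by move=> Fij; apply: ceq_swap (ceq_refl _). Qed.

Lemma ceq_sym w1 w2 : ceq w1 w2 -> ceq w2 w1.
Proof.
elim=> [w | u v i j w Fij _ IH]; first exact: ceq_refl.
by apply: ceq_trans IH _; apply: ceq_swap1; rewrite far_sym.
Qed.

Lemma ceq_cat z1 z2 w1 w2 : ceq w1 w2 -> ceq (z1 ++ w1 ++ z2) (z1 ++ w2 ++ z2).
Proof.
elim=> [w | u v i j w Fij _ IH]; first exact: ceq_refl.
rewrite -catA catA /=; apply: ceq_swap => //.
by move: IH; rewrite -catA catA.
Qed.

Lemma ceq_cons i w1 w2 : ceq w1 w2 -> ceq (i :: w1) (i :: w2).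
Proof. by move/(ceq_cat [:: i] [::]); rewrite /= !cats0. Qed.

Lemma ceq_size w1 w2 : ceq w1 w2 -> size w1 = size w2.
Proof. by elim=> // u v i j w _ _ <-; rewrite !size_cat. Qed.

Lemma ceq_move_front u z i :
  (forall k, k \in u -> far i k) -> ceq (u ++ i :: z) (i :: u ++ z).
Proof.
elim: u => [|k u IH] Fu /=; first exact: ceq_refl.
apply: (@ceq_trans (k :: i :: u ++ z)).
  by apply: ceq_cons; apply: IH => l ul; apply: Fu; rewrite inE ul orbT.
by apply: (@ceq_swap1 [::]); rewrite far_sym Fu ?mem_head.
Qed.

Lemma comm_equivP m (t t' : m.-tuple 'I_n) :
  reflect (ceq t t') (comm_equiv t t').
Proof.
apply: (iffP idP).
  case/connectP=> p; elim: p t => [|t1 p IH] t /=; first by move=> _ ->; apply: ceq_refl.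
  case/andP=> /asboolP[u [v [i [j [Fij -> Et1]]]]] /IH{}IH /IH.
  by rewrite Et1; apply: ceq_swap.
move Ew: (tval t) => w; move Ew': (tval t') => w' E.
elim: E t Ew Ew' => [{}w t Ew Ew' | u v i j {}w Fij _ IH t Et Et'].
  by rewrite (_ : t = t') ?/comm_equiv ?connect0 //; apply: val_inj; rewrite /= Ew Ew'.
have sz : size (u ++ [:: j, i & v]) == m.
  by rewrite -(size_tuple t) Et !size_cat.
apply: (@connect_trans _ _ (Tuple sz)); last exact: IH.
by apply: connect1; apply/asboolP; exists u, v, i, j.
Qed.

Definition proj i j w := [seq a <- w | (a == i) || (a == j)].

Lemma proj_cat i j u v : proj i j (u ++ v) = proj i j u ++ proj i j v.
Proof. exact: filter_cat. Qed.

Lemma projC i j w : proj i j w = proj j i w.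
Proof. by apply: eq_filter => a; rewrite orbC. Qed.

Lemma proj_id i w : proj i i w = nseq (count_mem i w) i.
Proof.
by elim: w => // a w; rewrite /proj /= orbb => ->; case: eqP => [->|].
Qed.

Lemma proj_rev i j w : proj i j (rev w) = rev (proj i j w).
Proof. exact: filter_rev. Qed.

Lemma count_proj i j w : count_mem i (proj i j w) = count_mem i w.
Proof.
rewrite count_filter; apply: eq_count => a /=.
by case: eqP.
Qed.

Lemma far_irr i : far i i = false.
Proof. rewrite /far; lia. Qed.

Lemma ceq_proj w1 w2 : ceq w1 w2 -> 
  forall i j, ~~ far i j -> proj i j w1 = proj i j w2.
Proof.
elim=> // u v i j w Fij _ IH a b Fab; rewrite -(IH a b Fab) !proj_cat; congr (_ ++ _).
rewrite /proj /=; case: (boolP (_ || _)) => // Hi; case: (boolP (_ || _)) => // Hj.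
exfalso; move: Fij Fab; case/orP: Hi => /eqP ->; case/orP: Hj => /eqP ->.
- by rewrite far_irr.
- by move=> ->.
- by rewrite far_sym => ->.
- by rewrite far_irr.
Qed.

(** The first letter [i] of [w1] occurs in [w2]. A letter before its first occurrence there and not
    far from [i] would make the projection of [w2] onto that pair begin wrongly. So [i] commutes to
    the front of [w2] and cancels. *)
Lemma proj_ceq w1 w2 :
  (forall i j, ~~ far i j -> proj i j w1 = proj i j w2) -> ceq w1 w2.
Proof.
elim: w1 w2 => [|i v IH] w2 E.
  case: w2 E => [|k w2 E]; first by move=> _; apply: ceq_refl.
  by have := E k k; rewrite far_irr /proj /= eqxx => /(_ isT).
have iw2 : i \in w2.
  have := E i i; rewrite far_irr => /(_ isT); rewrite /proj /= eqxx /= => Eii.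
  have : i \in [seq a <- w2 | (a == i) || (a == i)] by rewrite -Eii mem_head.
  by rewrite mem_filter => /andP[].
have [u [z [Ew2 iu]]] := split_first iw2; rewrite {}Ew2 {iw2} in E *.
have Fu k : k \in u -> far i k.
  move=> ku; apply/negPn/negP => /(E i k).
  rewrite proj_cat /proj /= eqxx /=.
  case Eu: (filter _ u) => [|a s] /=.
    have : k \in [seq a <- u | (a == i) || (a == k)].
      by rewrite mem_filter eqxx orbT.
    by rewrite Eu.
  case=> Ea _; case/negP: iu.
  have : a \in [seq a <- u | (a == i) || (a == k)] by rewrite Eu mem_head.
  by rewrite mem_filter Ea => /andP[].
have M := @ceq_move_front u z i Fu.
apply: ceq_trans (ceq_sym M); apply: ceq_cons; apply: IH => a b Fab.
have := E a b Fab; rewrite (ceq_proj M Fab) {1 2}/proj /=.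
by case: ifP => // _ [].
Qed.

Lemma ceq_count w1 w2 i : ceq w1 w2 -> count_mem i w1 = count_mem i w2.
Proof.
by move/ceq_proj => /(_ i i); rewrite far_irr => /(_ isT);
  rewrite !proj_id => /(congr1 size); rewrite !size_nseq.
Qed.

Lemma nonfarP i j : reflect [\/ i = j, j = i.+1 :> nat | i = j.+1 :> nat] (~~ far i j).
Proof.
apply: (iffP idP) => [|[->|E|E]]; rewrite /far; [|lia|lia|lia].
rewrite negb_or -!leqNgt => /andP[h1 h2].
have [/ord_inj ->|] := eqVneq (i : nat) j; first by constructor 1.
move=> ne; have : (j == i.+1 :> nat) || (i == j.+1 :> nat) by lia.
by case/orP=> /eqP ?; [constructor 2 | constructor 3].
Qed.

Lemma adj_proj_ceq w1 w2 :
    (forall i, count_mem i w1 = count_mem i w2) ->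
    (forall i j, j = i.+1 :> nat -> proj i j w1 = proj i j w2) ->
  ceq w1 w2.
Proof.
move=> C E; apply: proj_ceq => i j /nonfarP[<-|/E //|/E].
  by rewrite !proj_id C.
by rewrite !(projC j).
Qed.

End Words.

(** * Alternating sequences over two letters *)

Section Alt.
Variable T : eqType.
Implicit Types (x y : T) (s : seq T).

Fixpoint alt k x y : seq T := if k is k'.+1 then x :: alt k' y x else [::].

Lemma count_alt k x y : x != y ->
  (count_mem x (alt k x y) = uphalf k) * (count_mem y (alt k x y) = k./2).
Proof.
elim: k x y => // k IH x y ne; have [|IH1 IH2] := IH y x; first by rewrite eq_sym.
rewrite /= eqxx (negPf ne) IH1 IH2; split=> //; lia.
Qed.

Lemma rcons_alt k x y :
  rcons (alt k x y) (if odd k then y else x) = alt k.+1 x y.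
Proof. by elim: k x y => //= k IH x y; rewrite if_neg IH. Qed.

Lemma rev_alt k x y : rev (alt k x y) = if odd k then alt k x y else alt k y x.
Proof.
elim: k x y => // k IH x y; rewrite -[in LHS]rcons_alt rev_rcons IH /= if_neg.
by case: (odd k).
Qed.

Lemma sorted_alt k x y : x != y -> sorted [rel a b | a != b] (alt k x y).
Proof.
case: k => //= k; elim: k x y => //= k IH x y ne.
by rewrite ne IH // eq_sym.
Qed.

Lemma alt_sorted s x y : x != y ->
    all [pred a | (a == x) || (a == y)] s -> sorted [rel a b | a != b] s ->
  s = alt (size s) x y \/ s = alt (size s) y x.
Proof.
move=> ne; case: s => [|a s]; first by left.
elim: s a => [|b s IH] a /=.
  by rewrite andbT => /orP[] /eqP -> _; [left | right].
move=> /and3P[Ha Hb Hs] /andP[ab Hp].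
have /= := IH b; rewrite Hb Hs => /(_ isT Hp) IHb.
case/orP: Ha ab => /eqP -> ab; [left|right]; congr (_ :: _).
  case: IHb => E; rewrite E; case/orP: Hb ab => /eqP <-; rewrite ?eqxx //.
  by case: E => <-; rewrite eqxx.
case: IHb => E; rewrite E; case/orP: Hb ab => /eqP <-; rewrite ?eqxx //.
by case: E => <-; rewrite eqxx.
Qed.

(* The alternating sequence with a occurrences of x and b of y, starting with
   the more frequent letter. *)
Definition canon a b x y := if b < a then alt (a + b) x y else alt (a + b) y x.

End Alt.

(* Two adjacent columns of a self-dual alternating heap either differ in size
   by one or are both empty. *)
Definition hstep (a b : nat) := (b == a.+1) || (b == a.-1).

Lemma hstep_sym : symmetric hstep.
Proof. by move=> a b; rewrite /hstep; lia. Qed.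

Lemma rev_canon (T : eqType) a b (x y : T) :
  hstep a b -> rev (canon a b x y) = canon a b x y.
Proof.
rewrite /hstep /canon => st; case: ltnP => ab; rewrite rev_alt.
  by rewrite (_ : odd (a + b)); last lia.
case: (boolP (odd _)) => // ev; have -> : a + b = 0 by lia.
by [].
Qed.

Lemma canon_wrapl (T : eqType) m (x y : T) :
  canon m.+2 m.+1 x y = x :: rcons (canon m m.+1 x y) x.
Proof.
rewrite /canon ltnSn (_ : m.+1 < m = false); last lia.
rewrite (_ : m.+2 + m.+1 = (m + m.+1).+2); last lia.
by have := rcons_alt (m + m.+1) y x; rewrite (_ : odd _) => [->|]; last lia.
Qed.

Lemma canon_wrapr (T : eqType) m (x y : T) :
  canon m.+1 m.+2 x y = y :: rcons (canon m.+1 m x y) y.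
Proof.
rewrite /canon ltnSn (_ : m.+2 < m.+1 = false); last lia.
rewrite (_ : m.+1 + m.+2 = (m.+1 + m).+2); last lia.
by have := rcons_alt (m.+1 + m) x y; rewrite (_ : odd _) => [->|]; last lia.
Qed.

(** * Self-dual alternating words *)

Section SelfDual.
Variable n : nat.
Implicit Types (i j k : 'I_n) (u v w z : seq 'I_n).

Definition altword w := forall i j, j = i.+1 :> nat ->
  sorted [rel a b | a != b] (proj i j w).

Definition sdalt w := forall i j, j = i.+1 :> nat ->
  hstep (count_mem i w) (count_mem j w) /\
  proj i j w = canon (count_mem i w) (count_mem j w) i j.

Lemma alternating_wordP m (t : m.-tuple 'I_n) :
  reflect (altword t) (alternating_word t).
Proof.
apply: (iffP forallP) => [A i j E | A i].
  by have /forallP/(_ j) := A i; rewrite E eqxx.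
by apply/forallP=> j; apply/implyP=> /eqP; apply: A.
Qed.

Lemma adj_neq i j : j = i.+1 :> nat -> i != j.
Proof. by move=> E; rewrite -val_eqE /= E; lia. Qed.

(** Self-duality makes each projection onto two adjacent columns a palindrome. A nonempty
    alternating palindrome has odd length, so the counts differ by one and the more frequent letter
    stands at both ends. *)
Lemma sdaltP w : sdalt w <-> altword w /\ ceq w (rev w).
Proof.
split=> [A | [A D]].
  split=> [i j E|]; have := A.
    by case/(_ i j E) => _ ->; rewrite /canon; have ne := adj_neq E;
      case: ifP => _; apply: sorted_alt; rewrite // eq_sym.
  move=> _; apply: adj_proj_ceq => [i | i j E]; first by rewrite count_rev.
  by rewrite proj_rev; have [st ->] := A i j E; rewrite rev_canon.
move=> i j E; have ne := adj_neq E.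
have pal : rev (proj i j w) = proj i j w.
  rewrite -proj_rev; symmetry; apply: (ceq_proj D).
  by apply/nonfarP; constructor 2.
have := alt_sorted ne _ (A i j E); rewrite filter_all => /(_ isT).
rewrite -(count_proj i j w) -(count_proj j i w) (projC j i).
set p := proj i j w in pal *; set l := size p.
have oddl x y : x != y -> p = alt l x y -> odd l || (l == 0).
  move=> xy Ep; move: pal; rewrite Ep rev_alt; case: (odd l) => //=.
  by case: (l) => //= l' [yx]; rewrite yx eqxx in xy.
case=> Ep.
  have O := oddl _ _ ne Ep; rewrite Ep !(count_alt _ ne) /hstep /canon.
  split; first lia.
  case: ltnP => h; first by congr alt; lia.
  by have -> : l = 0 by lia.
have ne' : j != i by rewrite eq_sym.
have O := oddl _ _ ne' Ep; rewrite Ep !(count_alt _ ne') /hstep /canon.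
split; first lia.
case: ltnP => h; last by congr alt; lia.
by have -> : l = 0 by lia.
Qed.

Lemma sdalt_ceq w1 w2 : sdalt w1 -> sdalt w2 ->
  (forall i, count_mem i w1 = count_mem i w2) -> ceq w1 w2.
Proof.
move=> A1 A2 C; apply: adj_proj_ceq => // i j E.
by have [_ ->] := A1 i j E; have [_ ->] := A2 i j E; rewrite !C.
Qed.

Lemma ceq_sdalt w1 w2 : ceq w1 w2 -> sdalt w1 -> sdalt w2.
Proof.
move=> D A i j E; rewrite -!(ceq_count _ D) -(ceq_proj D); first exact: A.
by apply/nonfarP; constructor 2.
Qed.

(* A maximal entry of the count vector is one more than its neighbours, so it
   can be wrapped around a word in which it is lowered by two. *)
Lemma sdalt_exists (a : 'I_n -> nat) :
    (forall i j, j = i.+1 :> nat -> hstep (a i) (a j)) ->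
  exists w, sdalt w /\ forall i, count_mem i w = a i.
Proof.
move: {2}(\sum_i a i).+1 (ltnSn (\sum_i a i)) => N.
elim: N a => // N IH a ltN st.
have [all0 | /existsP[k0 ak0]] := boolP [forall i, a i == 0].
  have a0 i : a i = 0 by apply/eqP/(forallP all0).
  by exists [::]; split=> [i j E|i]; rewrite ?a0.
have [i0 _ max0] := @arg_maxnP _ k0 xpredT a isT.
have a0_gt0 : 0 < a i0 by have := max0 k0 isT; lia.
pose a' k := if k == i0 then a i0 - 2 else a k.
have lt' : \sum_i a' i < N.
  apply: leq_trans (_ : \sum_i a i <= N) => //.
  rewrite [ltnRHS](bigD1 i0) // [ltnLHS](bigD1 i0) //= {1}/a' eqxx.
  rewrite (eq_bigr a) => [|i /negPf ni]; last by rewrite /a' ni.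
  by rewrite ltn_add2r; lia.
(* A nonempty neighbour of the maximum has size [a i0 - 1], again one away from [a i0 - 2]. If the
   maximum is 1, truncated subtraction gives 0 beside empty columns. *)
have st' i j : j = i.+1 :> nat -> hstep (a' i) (a' j).
  move=> E; have := st i j E; have := max0 i isT; have := max0 j isT.
  have ne := adj_neq E; rewrite /a' /hstep.
  case: (eqVneq i i0) ne => [->|_] ne.
    by rewrite [j == i0]eq_sym (negPf ne); lia.
  by case: (eqVneq j i0) => [->|_]; lia.
have [w' [A' C']] := IH a' lt' st'.
have nei k : (k != i0) -> count_mem k w' = a k by rewrite C' /a' => /negPf ->.
have Ci0 : count_mem i0 w' = a i0 - 2 by rewrite C' /a' eqxx.
have key (w : seq 'I_n) : 
    (forall i j, i0 \notin [:: i; j] -> proj i j w = proj i j w') ->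
    (forall k, count_mem k w = a k) ->
    (forall j, j = i0.+1 :> nat -> proj i0 j w = canon (a i0) (a j) i0 j) ->
    (forall i, i0 = i.+1 :> nat -> proj i i0 w = canon (a i) (a i0) i i0) ->
    exists w, sdalt w /\ forall i, count_mem i w = a i.
  move=> P0 C Pl Pr; exists w; split=> // i j E.
  rewrite !C; split; first exact: st.
  have [Ei | ni] := eqVneq i i0; first by subst i; apply: Pl.
  have [Ej | nj] := eqVneq j i0; first by subst j; apply: Pr.
  rewrite P0; last by rewrite !inE negb_or !(eq_sym i0) ni nj.
  by have [_ ->] := A' i j E; rewrite !nei.
(* A maximum equal to 1 takes a single letter in front; a larger one takes a letter at each end. *)
case Ea: (a i0) a0_gt0 => [|[|m]] // _.
  apply: (key (i0 :: w')) => [i j|k|j E|i E].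
  - by rewrite !inE negb_or /proj /= => /andP[/negPf-> /negPf->].
  - rewrite /=; case: eqVneq => [<-|nk]; first by rewrite Ci0 Ea.
    by rewrite nei // eq_sym.
  - have ne := adj_neq E; have := st _ _ E; have := max0 j isT.
    rewrite Ea /hstep => h1 h2; have aj : a j = 0 by lia.
    rewrite aj /proj /= eqxx -/(proj i0 j w'); have [_ ->] := A' _ _ E.
    by rewrite Ci0 Ea nei 1?eq_sym // aj.
  - have ne := adj_neq E; have := st _ _ E; have := max0 i isT.
    rewrite Ea /hstep => h1 h2; have ai : a i = 0 by lia.
    rewrite ai /proj /= eqxx orbT -/(proj i i0 w'); have [_ ->] := A' _ _ E.
    by rewrite Ci0 Ea nei // ai.
apply: (key (i0 :: rcons w' i0)) => [i j|k|j E|i E].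
- rewrite !inE negb_or /proj /= filter_rcons => /andP[/negPf-> /negPf->].
  by [].
- rewrite /= -cats1 count_cat /=; case: eqVneq => [<-|nk].
    by rewrite Ci0 Ea; lia.
  by rewrite nei 1?eq_sym //; lia.
- have ne := adj_neq E; have := st _ _ E; have := max0 j isT.
  rewrite Ea /hstep => h1 h2; have aj : a j = m.+1 by lia.
  rewrite aj /proj /= filter_rcons eqxx -/(proj i0 j w'); have [_ ->] := A' _ _ E.
  by rewrite Ci0 Ea nei 1?eq_sym // aj canon_wrapl subn2.
- have ne := adj_neq E; have := st _ _ E; have := max0 i isT.
  rewrite Ea /hstep => h1 h2; have ai : a i = m.+1 by lia.
  rewrite ai /proj /= filter_rcons eqxx orbT -/(proj i i0 w'); have [_ ->] := A' _ _ E.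
  by rewrite Ci0 Ea nei // ai canon_wrapr subn2.
Qed.

End SelfDual.

(** * Count vectors *)

Section CountVector.
Variable n : nat.
Implicit Types (i j k : 'I_n) (w : seq 'I_n).

Definition cvec w : seq nat := [seq count_mem i w | i <- enum 'I_n].

Lemma size_cvec w : size (cvec w) = n.
Proof. by rewrite size_map size_enum_ord. Qed.

Lemma nth_cvec w i : nth 0 (cvec w) i = count_mem i w.
Proof. by rewrite (nth_map i) ?size_enum_ord // nth_ord_enum. Qed.

Lemma sumn_cvec w : sumn (cvec w) = size w.
Proof.
rewrite sumnE big_map big_enum /=.
elim: w => [|a w IH]; first by rewrite big1.
rewrite big_split /= IH (bigD1 a) //= eqxx big1 // => i /negPf ni.
by rewrite eq_sym ni.
Qed.

Lemma eq_cvecP w1 w2 :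
  cvec w1 = cvec w2 <-> forall i, count_mem i w1 = count_mem i w2.
Proof.
split=> [E i | E]; first by rewrite -!nth_cvec E.
by apply: eq_map => i; rewrite E.
Qed.

Lemma sorted_cvecP w : 
  (forall i j, j = i.+1 :> nat -> hstep (count_mem i w) (count_mem j w)) <->
  sorted hstep (cvec w).
Proof.
split=> [st | /(sortedP 0) st i j E].
  apply/(sortedP 0) => i; rewrite size_cvec => lt_in.
  rewrite (nth_cvec w (Ordinal (ltnW lt_in))) (nth_cvec w (Ordinal lt_in)).
  exact: st.
by have := st i; rewrite size_cvec -E ltn_ord !nth_cvec; apply.
Qed.

Lemma sdalt_sorted w : sdalt w -> sorted hstep (cvec w).
Proof. by move=> A; apply/sorted_cvecP => i j /A[]. Qed.

Lemma sdalt_of_cvec (s : seq nat) : size s = n -> sorted hstep s ->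
  exists w, sdalt w /\ cvec w = s.
Proof.
move=> sz st; have [|w [A C]] := @sdalt_exists n (fun i => nth 0 s i).
  by move=> i j E; rewrite E; apply: (sortedP 0 st); rewrite sz -E.
exists w; split=> //; apply: (@eq_from_nth _ 0); rewrite size_cvec ?sz // => i lt_in.
by rewrite (nth_cvec w (Ordinal lt_in)) C.
Qed.

End CountVector.

(** Bijections are stated as permutations of lists so that both cardinalities and sums of powers of
    [q] can be carried along them. *)
Lemma perm_eq_image (T : finType) (U : eqType) (A : {pred T}) (f : T -> U) l :
    {in A &, injective f} -> uniq l ->
    (forall u, u \in l <-> exists2 x, x \in A & f x = u) ->
  perm_eq [seq f x | x in A] l.
Proof.
move=> inj_f Ul lE; apply: uniq_perm => //.
  rewrite map_inj_in_uniq ?enum_uniq // => x y.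
  by rewrite !mem_enum; apply: inj_f.
move=> u; apply/imageP/idP => [[x Ax ->] | /lE[x Ax <-]]; last by exists x.
by apply/lE; exists x.
Qed.

(** * Counting self-dual alternating heaps *)

Section HeapCount.
Variables n m : nat.
Implicit Types (t : m.-tuple 'I_n) (H : {set m.-tuple 'I_n}).

Lemma comm_equiv_class t : [set t' | comm_equiv t t'] \in heaps n m.
Proof.
apply/imsetP; exists t; rewrite ?inE //.
by apply/setP=> t'; rewrite !inE.
Qed.

Lemma mem_heap H t t' : H \in heaps n m -> t \in H ->
  (t' \in H) = comm_equiv t t'.
Proof.
case/imsetP=> t0 _ ->; rewrite !inE /= => /comm_equivP E.
apply/comm_equivP/comm_equivP; last exact: ceq_trans.
exact: ceq_trans (ceq_sym E).
Qed.

Lemma heap_nonempty H : H \in heaps n m -> exists t, t \in H.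
Proof.
by case/imsetP=> t _ ->; exists t; rewrite !inE; apply/comm_equivP/ceq_refl.
Qed.

(** The witnesses of [alternating] and [self_dual] may be different words. Alternation passes to the
    self-dual witness through the projections, and [sdalt] then passes to the whole class. *)
Lemma sdalt_heapP H t : H \in heaps n m -> t \in H ->
  reflect (sdalt t) (alternating H && self_dual H).
Proof.
move=> HH tH; apply: (iffP andP) => [[/existsP[t1 /andP[t1H A1]]] | A].
  case/existsP=> t2 /andP[t2H]; rewrite (mem_heap _ HH t2H) => /comm_equivP D2.
  move: tH t2H; rewrite !(mem_heap _ HH t1H) => /comm_equivP E /comm_equivP E2.
  apply: (ceq_sdalt E); apply: (ceq_sdalt (ceq_sym E2)); apply/sdaltP; split=> //.
  move=> i j Eij; rewrite -(ceq_proj E2); first by move/alternating_wordP: A1; apply.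
  by apply/nonfarP; constructor 2.
have [A1 A2] := (sdaltP t).1 A; split; apply/existsP; exists t; rewrite tH /=.
  exact/alternating_wordP.
by rewrite (mem_heap _ HH tH); apply/comm_equivP.
Qed.

Definition hvec H := if [pick t in H] is Some t then cvec t else [::].

Lemma hvecE H t : H \in heaps n m -> t \in H -> hvec H = cvec t.
Proof.
move=> HH tH; rewrite /hvec; case: pickP => [t'|/(_ t)]; last by rewrite tH.
move=> t'H; apply/eq_cvecP => i; apply: ceq_count.
by apply/comm_equivP; rewrite -(mem_heap _ HH t'H).
Qed.

(** The map [hvec] is injective by [sdalt_ceq] and reaches all of [l] by [sdalt_of_cvec]. The
    predicate [Q] carries the condition on the last column, or is trivial for the series of all
    heaps. *)
Lemma card_sd_alt (Q : pred {set m.-tuple 'I_n}) (P : pred (seq nat)) l :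
    (forall H t, H \in heaps n m -> t \in H -> Q H = P (cvec t)) -> uniq l ->
    (forall u, (u \in l) =
       [&& size u == n, sorted hstep u, P u & sumn u == m]) ->
  #|[set H in heaps n m | [&& alternating H, self_dual H & Q H]]| = size l.
Proof.
move=> QP Ul lE; set A := finset _.
have AP H t : H \in heaps n m -> t \in H -> H \in A -> sdalt t /\ P (cvec t).
  move=> HH tH; rewrite inE HH /= andbA => /andP[/(sdalt_heapP HH tH) ? PH].
  by rewrite -(QP _ _ HH tH).
have /perm_size <- : perm_eq [seq hvec H | H in A] l; last by rewrite size_map cardE.
apply: perm_eq_image => // [H1 H2 A1 A2 E | u].
  have HH1 : H1 \in heaps n m by move: A1; rewrite inE => /andP[].
  have HH2 : H2 \in heaps n m by move: A2; rewrite inE => /andP[].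
  have [[t1 tH1] [t2 tH2]] := (heap_nonempty HH1, heap_nonempty HH2).
  move: E; rewrite (hvecE HH1 tH1) (hvecE HH2 tH2) => /eq_cvecP C.
  have [S1 _] := AP _ _ HH1 tH1 A1; have [S2 _] := AP _ _ HH2 tH2 A2.
  have D := sdalt_ceq S1 S2 C; apply/setP=> t.
  rewrite (mem_heap _ HH1 tH1) (mem_heap _ HH2 tH2).
  apply/comm_equivP/comm_equivP; last exact: ceq_trans.
  exact: ceq_trans (ceq_sym D).
rewrite lE; split=> [/and4P[/eqP sz st Pu /eqP sm] | [H AH <-]].
  have [w [Aw Cw]] := sdalt_of_cvec sz st.
  have szw : size w == m by rewrite -sumn_cvec Cw sm.
  pose t := Tuple szw; pose H := [set t' | comm_equiv t t'].
  have HH : H \in heaps n m by apply: comm_equiv_class.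
  have tH : t \in H by rewrite inE; apply/comm_equivP/ceq_refl.
  exists H; last by rewrite (hvecE HH tH).
  rewrite inE HH (QP _ _ HH tH) Cw Pu andbT /=.
  by apply/(sdalt_heapP HH tH).
have HH : H \in heaps n m by move: AH; rewrite inE => /andP[].
have [t tH] := heap_nonempty HH; have [St Pt] := AP _ _ HH tH AH.
by rewrite (hvecE HH tH) size_cvec sumn_cvec size_tuple !eqxx Pt sdalt_sorted.
Qed.

End HeapCount.

Lemma last_cvec n (w : seq 'I_n) :
  last 0 (cvec w) = count (fun i : 'I_n => i.+1 == n) w.
Proof.
case: n w => [|n] w; first by case: w => [|[]] //; rewrite /cvec enum_ord0.
rewrite -nth_last size_cvec (nth_cvec w ord_max); apply: eq_count => i /=.
by rewrite -val_eqE.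
Qed.

Lemma last_le1_cvec n m (H : {set m.-tuple 'I_n}) t : H \in heaps n m -> t \in H ->
  last_le1 H = (last 0 (cvec t) <= 1).
Proof.
move=> HH tH; rewrite last_cvec; apply/existsP/idP => [[t'] | le1]; last first.
  by exists t; rewrite tH.
case/andP; rewrite (mem_heap _ HH tH) => /comm_equivP E.
rewrite -!last_cvec; suff -> : cvec t = cvec t' by [].
by apply/eq_cvecP => i; apply: ceq_count.
Qed.

(** * Strands *)

(* The letters are shifted to 1, ..., n: then 0 and n + 1 never occur, and the
   conditions on the two end columns become instances of alternation. *)
Definition shift n (w : seq 'I_n) : seq nat := [seq i.+1 | i : 'I_n <- w].

(* Every occurrence of a in s is preceded by an occurrence of b. *)
Fixpoint pre (b a : nat) (s : seq nat) : bool :=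
  if s is c :: s' then (c == b) || (c != a) && pre b a s' else true.

(** Between two occurrences of a positive letter both neighbouring letters occur. *)
Fixpoint good (s : seq nat) : bool :=
  if s is a :: s' then [&& pre a.+1 a s', pre a.-1 a s' & good s'] else true.

(** The transposition of positions [c - 1] and [c], on naturals; [run] follows one strand through
    the whole word. *)
Definition swp (c x : nat) := if x == c.-1 then c else if x == c then c.-1 else x.

Definition run (s : seq nat) (x : nat) := foldl (fun x c => swp c x) x s.

Lemma pre_total a b s : a != b -> pre a b s || pre b a s.
Proof.
move=> ne; elim: s => //= c s IH.
by case: (eqVneq c a) => [->|_] //=; case: (eqVneq c b) => //= _; rewrite orbT.
Qed.

Lemma pre_mem_cat a b u z : b \in u -> a \notin u -> pre b a (u ++ z).
Proof.
elim: u => //= c u IH; rewrite !inE negb_or eq_sym => Hb /andP[ac au].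
case: eqP Hb => //= _ /IH{}IH; rewrite eq_sym ac /=; exact: IH.
Qed.

Lemma pre_notin a b s : a \notin s -> pre b a s.
Proof.
elim: s => //= c s IH; rewrite inE negb_or eq_sym => /andP[-> /IH ->].
by rewrite orbT.
Qed.

Lemma path_pre x y s : x != y ->
  path [rel a b | a != b] x [seq a <- s | (a == x) || (a == y)] =
  pre y x s && sorted [rel a b | a != b] [seq a <- s | (a == x) || (a == y)].
Proof.
move=> ne; elim: s => //= c s IH.
case: (eqVneq c x) => [->|nx] /=; first by rewrite eqxx (negPf ne).
by case: (eqVneq c y) => [->|ny] //=; rewrite ne.
Qed.

(** By [path_pre], prefixing [c] keeps a projection containing [c] alternating exactly when the
    neighbour comes before the next [c]. *)
Lemma goodP s : reflect
  (forall x, sorted [rel a b | a != b] [seq a <- s | (a == x) || (a == x.+1)])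
  (good s).
Proof.
apply: (iffP idP) => [|A].
  elim: s => //= c s IH /and3P[p1 p2 /IH{}IH] x.
  case: (eqVneq c x) => [E|nx] /=.
    by subst c; rewrite path_pre ?IH ?p1 // neq_ltn ltnSn.
  case: (eqVneq c x.+1) => [E|ny] //=; subst c.
  have fE : [seq a <- s | (a == x) || (a == x.+1)] =
            [seq a <- s | (a == x.+1) || (a == x)].
    by apply: eq_filter => a; rewrite orbC.
  by rewrite fE path_pre // p2 /= -fE IH.
elim: s A => //= c s IH A; rewrite IH ?andbT => [|x].
  apply/andP; split.
    by have := A c; rewrite eqxx /= path_pre ?neq_ltn ?ltnSn // => /andP[].
  case: c A => [|c] A /=; first by elim: (s) => //= a s' ->; case: eqP.
  have := A c; rewrite eqxx orbT /=.
  have -> : [seq a <- s | (a == c) || (a == c.+1)] = [seq a <- s | (a == c.+1) || (a == c)].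
    by apply: eq_filter => a; rewrite orbC.
  by rewrite path_pre ?neq_ltn ?ltnSn ?orbT // => /andP[].
by have := A x; case: ifP => //= _ /path_sorted.
Qed.

Ltac swp_lia :=
  rewrite /swp /=;
  repeat match goal with |- context [if ?x == ?y then _ else _] =>
    match x with
    | context [if _ then _ else _] => fail 1
    | _ => case: (x =P y) => ?
    end
  end; lia.

Lemma swpK c : involutive (swp c).
Proof. by move=> x; swp_lia. Qed.

(* In a good word a strand keeps moving in the direction of its first move. *)
Lemma run_right s x : good s -> 0 \notin s -> pre x.+1 x s -> x <= run s x.
Proof.
elim: s x => //= c s IH x /and3P[p1 p2 gs].
rewrite inE negb_or => /andP[c0 s0].
case: (eqVneq c x.+1) => [Ec _ | nc /= /andP[nx px]].
  rewrite /swp Ec eqxx; apply: leq_trans (leqnSn x) _; apply: IH => //.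
  by rewrite -Ec.
rewrite (_ : swp c x = x); first exact: IH.
by swp_lia.
Qed.

Lemma run_left s x : good s -> 0 \notin s -> pre x x.+1 s -> run s x <= x.
Proof.
elim: s x => //= c s IH x /and3P[p1 p2 gs].
rewrite inE negb_or => /andP[c0 s0].
case: (eqVneq c x) => [Ec _ | nc /= /andP[nx px]].
  have -> : swp c x = x.-1 by swp_lia.
  apply: leq_trans (leq_pred x); apply: IH => //.
  by rewrite prednK -?Ec // lt0n eq_sym.
rewrite (_ : swp c x = x); first exact: IH.
by swp_lia.
Qed.

(** Each letter preserves the hypotheses on both strands. The critical case is [y = x.+1]: the
    strand at [y] has to leave to the right before a letter [y] can exchange the two. *)
Lemma run_right2 s x y : good s -> 0 \notin s ->
  pre x.+1 x s -> pre y.+1 y s -> x < y -> run s x < run s y.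
Proof.
elim: s x y => //= c s IH x y /and3P[p1 p2 gs].
rewrite inE negb_or => /andP[c0 s0] px py lt_xy.
have px' : pre (swp c x).+1 (swp c x) s.
  case: (eqVneq c x.+1) px => [Ec _ | nc /= /andP[nx px]].
    by have -> : swp c x = c by swp_lia.
  by have -> : swp c x = x by swp_lia.
have py' : pre (swp c y).+1 (swp c y) s.
  case: (eqVneq c y.+1) py => [Ec _ | nc /= /andP[nx py]].
    by have -> : swp c y = c by swp_lia.
  by have -> : swp c y = y by swp_lia.
apply: IH => //.
have : (c == y.+1) || (c != y) by case/orP: py => [->|/andP[-> _]]; rewrite ?orbT.
have : (c == x.+1) || (c != x) by case/orP: px => [->|/andP[-> _]]; rewrite ?orbT.
by swp_lia.
Qed.

Lemma run_left2 s x y : good s -> 0 \notin s ->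
  pre x x.+1 s -> pre y y.+1 s -> x < y -> run s x < run s y.
Proof.
elim: s x y => //= c s IH x y /and3P[p1 p2 gs].
rewrite inE negb_or => /andP[c0 s0] px py lt_xy.
have px' : pre (swp c x) (swp c x).+1 s.
  case: (eqVneq c x) px => [Ec _ | nc /= /andP[nx px]].
    have -> : swp c x = c.-1 by swp_lia.
    by rewrite prednK // lt0n eq_sym.
  by have -> : swp c x = x by swp_lia.
have py' : pre (swp c y) (swp c y).+1 s.
  case: (eqVneq c y) py => [Ec _ | nc /= /andP[nx py]].
    have -> : swp c y = c.-1 by swp_lia.
    by rewrite prednK // lt0n eq_sym.
  by have -> : swp c y = y by swp_lia.
apply: IH => //.
have : (c == y) || (c != y.+1) by case/orP: py => [->|/andP[-> _]]; rewrite ?orbT.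
have : (c == x) || (c != x.+1) by case/orP: px => [->|/andP[-> _]]; rewrite ?orbT.
by swp_lia.
Qed.

(** The letter [c.+1] exchanges these strands. By hypothesis one of them does not start inward;
    either the other does not either, and they part, or it starts towards the first and follows
    it. *)
Lemma run_ascent s c : good s -> 0 \notin s ->
  pre c c.+1 s || pre c.+2 c.+1 s -> run s c < run s c.+1.
Proof.
move=> gs s0 /orP[pl | pr].
  have [pr|npr] := boolP (pre c.+2 c.+1 s).
    by apply: leq_ltn_trans (run_left gs s0 pl) _; apply: run_right.
  apply: run_left2 => //.
  by have := @pre_total c.+1 c.+2 s; rewrite (negPf npr) orbF; apply; lia.
have [pl|npl] := boolP (pre c c.+1 s).
  by apply: leq_ltn_trans (run_left gs s0 pl) _; apply: run_right.
apply: run_right2 => //.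
by have := @pre_total c c.+1 s; rewrite (negPf npl) /=; apply; lia.
Qed.

(** * Permutations and inversions *)

Section Perm.
Variable n : nat.
Implicit Types (i j k : 'I_n) (w : seq 'I_n) (s : {perm 'I_n.+1}).

Lemma sgenE i (x : 'I_n.+1) : sgen i x = swp i.+1 x :> nat.
Proof.
rewrite /sgen /swp /=; case: tpermP => [->|->|n1 n2] /=.
- by rewrite eqxx.
- by rewrite /bump /= add1n; swp_lia.
- have /negPf -> : (x : nat) != i.
    by apply: contra_not_neq n1 => E; apply: val_inj; rewrite /= E.
  have /negPf -> // : (x : nat) != i.+1.
  by apply: contra_not_neq n2 => E; apply: val_inj; rewrite /= E.
Qed.

Lemma wprod_cons i w : wprod (i :: w) = (sgen i * wprod w)%g.
Proof. by rewrite /wprod big_cons. Qed.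

Lemma wprodE w (x : 'I_n.+1) : wprod w x = run (shift w) x :> nat.
Proof.
elim: w x => [|i w IH] x /=; first by rewrite /wprod big_nil perm1.
by rewrite wprod_cons permM IH sgenE.
Qed.

Lemma wprod_rev w : wprod (rev w) = ((wprod w)^-1)%g.
Proof.
elim: w => [|i w IH]; first by rewrite /wprod !big_nil invg1.
rewrite rev_cons -cats1 /wprod big_cat big_seq1 /= -!/(wprod _) IH wprod_cons invMg.
by rewrite /sgen tpermV.
Qed.

Lemma eq_wprod_run w1 w2 :
  (forall x, run (shift w1) x = run (shift w2) x) -> wprod w1 = wprod w2.
Proof. by move=> E; apply/permP=> x; apply: val_inj; rewrite /= !wprodE E. Qed.

Lemma run_cat (t1 t2 : seq nat) x : run (t1 ++ t2) x = run t2 (run t1 x).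
Proof. exact: foldl_cat. Qed.

Lemma wprod_ceq w1 w2 : ceq w1 w2 -> wprod w1 = wprod w2.
Proof.
elim=> // u v i j w Fij _ <-; apply: eq_wprod_run => x.
rewrite /shift !map_cat !run_cat /=; congr foldl; move: Fij.
by rewrite /far; swp_lia.
Qed.

Lemma wprod_braid u v i j : ~~ far i j -> i != j ->
  wprod (u ++ [:: i, j, i & v]) = wprod (u ++ [:: j, i, j & v]).
Proof.
move=> Fij ne; apply: eq_wprod_run => x.
rewrite /shift !map_cat !run_cat /=; congr foldl; move: Fij ne.
by rewrite -val_eqE /far; swp_lia.
Qed.

Lemma wprod_double u v i : wprod (u ++ [:: i, i & v]) = wprod (u ++ v).
Proof.
apply: eq_wprod_run => x; rewrite /shift !map_cat !run_cat /=.
by rewrite swpK.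
Qed.

Definition inv s : nat :=
  \sum_(p : 'I_n.+1 * 'I_n.+1) ((p.1 < p.2) && (s p.2 < s p.1)).

Lemma inv1 : inv 1%g = 0.
Proof. by rewrite /inv big1 // => p _; rewrite !perm1; lia. Qed.

Lemma inv_sgen_ascent i s :
    s (widen_ord (leqnSn n) i) < s (lift ord0 i) ->
  inv (sgen i * s)%g = (inv s).+1.
Proof.
set a := widen_ord _ _; set b := lift _ _ => asc.
have ab : (sgen i a = b) * (sgen i b = a) by split; rewrite /sgen ?tpermL ?tpermR.
have [bE aE] : b = i.+1 :> nat /\ a = i :> nat by [].
clearbody a b.
(* Exchanging the two points in both coordinates changes the order of no pair except [(a, b)] and
   [(b, a)], which account for the one new inversion. *)
pose f (p : 'I_n.+1 * 'I_n.+1) := (sgen i p.1, sgen i p.2).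
have fK : involutive f by case=> x y; rewrite /f /= /sgen !tpermK.
rewrite /inv (reindex_inj (inv_inj fK)) /=.
rewrite [in LHS](bigD1 (b, a)) // [in RHS](bigD1 (a, b)) //=.
have neq : (a, b) != (b, a) by rewrite xpair_eqE -!val_eqE /= bE aE; lia.
rewrite [in LHS](bigD1 (a, b)) // [in RHS](bigD1 (b, a)) //=; last by rewrite eq_sym.
rewrite !ab !permM !ab asc bE aE ltnSn (_ : (i.+1 < i) = false) /=; last lia.
rewrite (ltnNge (s b) (s a)) (ltnW asc) /= !add0n add1n; congr (_.+1).
rewrite (eq_bigl (fun p => (p != (a, b)) && (p != (b, a)))); last first.
  by move=> p; rewrite andbC.
apply: eq_bigr => -[x y] /= /andP[n1 n2].
rewrite !permM {1 2}/sgen !tpermK; congr (nat_of_bool (_ && _)).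
rewrite -/(sgen i) !sgenE; move: n1 n2; rewrite !xpair_eqE -!val_eqE /= bE aE.
by swp_lia.
Qed.

Lemma inv_sgen_descent i s :
    ~~ (s (widen_ord (leqnSn n) i) < s (lift ord0 i)) ->
  inv s = (inv (sgen i * s)%g).+1.
Proof.
move=> desc; rewrite -(@inv_sgen_ascent i).
  by rewrite mulgA /sgen tperm2 mul1g.
rewrite !permM /sgen tpermL tpermR ltn_neqAle leqNgt desc andbT.
by rewrite (inj_eq val_inj) (inj_eq perm_inj) -val_eqE /= /bump /=; lia.
Qed.

Lemma inv_wprod_le w : inv (wprod w) <= size w.
Proof.
elim: w => [|i w IH]; first by rewrite /wprod big_nil inv1.
rewrite wprod_cons /=; set s := wprod w in IH *.
case: (boolP (s (widen_ord (leqnSn n) i) < s (lift ord0 i))) => [asc|desc].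
  by rewrite inv_sgen_ascent.
by rewrite (inv_sgen_descent desc) in IH; apply: leq_trans (leqnSn _); apply: ltnW.
Qed.

Lemma shift0 w : 0 \notin shift w.
Proof. by apply/mapP=> -[]. Qed.

Lemma ascent_wprod i w : good (shift w) ->
    pre i i.+1 (shift w) || pre i.+2 i.+1 (shift w) ->
  wprod w (widen_ord (leqnSn n) i) < wprod w (lift ord0 i).
Proof. by move=> gw p; rewrite !wprodE; apply: run_ascent (shift0 w) p. Qed.

(** By [ascent_wprod] every letter, added from the left, creates an inversion; hence good words are
    reduced. *)
Lemma inv_good w : good (shift w) -> inv (wprod w) = size w.
Proof.
elim: w => [|i w IH]; first by rewrite /wprod big_nil inv1.
rewrite /= => /and3P[p1 p2 gw]; rewrite wprod_cons inv_sgen_ascent ?IH //.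
by apply: ascent_wprod; rewrite ?p2.
Qed.

Lemma coxlen_le w : coxlen (wprod w) <= size w.
Proof.
rewrite /coxlen; case: ex_minnP => m _; apply; apply/existsP.
by exists (in_tuple w).
Qed.

Lemma coxlen_word s : exists w, wprod w = s /\ size w = coxlen s.
Proof.
rewrite /coxlen; case: ex_minnP => m /existsP[t /eqP Et] _.
by exists t; rewrite size_tuple.
Qed.

Lemma coxlen_good w : good (shift w) -> coxlen (wprod w) = size w.
Proof.
move=> gw; apply/eqP; rewrite eqn_leq coxlen_le /= -(inv_good gw).
by have [w' [<- <-]] := coxlen_word (wprod w); apply: inv_wprod_le.
Qed.

Lemma ceq_good w1 w2 : ceq w1 w2 -> good (shift w1) -> good (shift w2).
Proof.
move=> E /goodP A; apply/goodP=> x; have := A x; congr sorted.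
elim: E => // u v i j w Fij _ <-; rewrite /shift !map_cat !filter_cat /=.
congr (_ ++ _); case: ifP => // Hi; case: ifP => // Hj.
by exfalso; move: Fij Hi Hj; rewrite /far; lia.
Qed.

(** If the first letter [i] of [w'] were an ascent of the product, the rest of [w'] would be too
    short for its inversions. So [i] is a descent; by [ascent_wprod] it occurs in [w] before both
    its neighbours, commutes to the front and cancels. *)
Lemma good_ceq w w' : good (shift w) -> wprod w = wprod w' ->
  size w' = size w -> ceq w w'.
Proof.
elim: w' w => [|i w' IH] w gw E /= sz.
  by case: w sz {gw E} => // _; apply: ceq_refl.
have desc : ~~ (wprod w (widen_ord (leqnSn n) i) < wprod w (lift ord0 i)).
  apply/negP=> /inv_sgen_ascent; rewrite (inv_good gw) E wprod_cons mulgA.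
  rewrite /sgen tperm2 mul1g => Ei.
  by have := inv_wprod_le w'; rewrite Ei -sz; lia.
have := contra (@ascent_wprod i w gw) desc; rewrite negb_or => /andP[np1 np2].
have iw : i \in w.
  apply/negPn/negP => iw; case/negP: np1; apply: pre_notin.
  by apply: contra iw => /mapP[k kw [/val_inj ->]].
have [u [z [Ew iu]]] := split_first iw.
have siu : i.+1 \notin shift u by apply: contra iu => /mapP[k ku [/val_inj ->]].
have Fu k : k \in u -> far i k.
  move=> ku; apply/negPn/negP => /nonfarP[Eik|Eik|Eik].
  - by rewrite Eik ku in iu.
  - case/negP: np2; rewrite Ew /shift map_cat; apply: pre_mem_cat => //.
    by apply/mapP; exists k => //; rewrite Eik.
  - case/negP: np1; rewrite Ew /shift map_cat; apply: pre_mem_cat => //.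
    by apply/mapP; exists k => //; rewrite Eik.
have M := @ceq_move_front n u z i Fu; rewrite -Ew in M.
apply: (ceq_trans M); apply: ceq_cons; apply: IH.
- by have := ceq_good M gw; rewrite /= => /and3P[].
- move: E; rewrite (wprod_ceq M) !wprod_cons; exact: mulgI.
- by have := ceq_size M; rewrite -sz /= => -[].
Qed.

Lemma good_fully_commutative w : good (shift w) -> fully_commutative (wprod w).
Proof.
move=> gw; apply/forallP=> t; apply/forallP=> t'; apply/implyP=> /andP[/eqP E /eqP E'].
apply/comm_equivP; have sz := coxlen_good gw.
apply: ceq_trans (ceq_sym _) _; apply: good_ceq gw _ _; rewrite ?E ?E' //.
  by rewrite size_tuple.
by rewrite size_tuple.
Qed.

End Perm.

(** * Reduced words of fully commutative elements *)

Section FullyCommutative.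
Variable n : nat.
Implicit Types (i j k : 'I_n) (u v w z : seq 'I_n) (s : {perm 'I_n.+1}).

Definition braidfree w := forall w', ceq w w' -> forall u z i,
  w' <> u ++ [:: i, i & z] /\
  forall k, ~~ far i k -> i != k -> w' <> u ++ [:: i, k, i & z].

Lemma fc_ceq s w w' : fully_commutative s ->
    wprod w = s -> size w = coxlen s -> wprod w' = s -> size w' = coxlen s ->
  ceq w w'.
Proof.
move=> fc E sz E' sz'; move/eqP in sz; move/eqP in sz'.
have /forallP/(_ (Tuple sz))/forallP/(_ (Tuple sz')) := fc.
by rewrite /= E E' !eqxx /= => /comm_equivP.
Qed.

(** A factor [i i] could be deleted, against minimality. A braid move on [i k i] gives another
    reduced word with fewer letters [i], whereas commutations preserve their number. *)
Lemma fc_braidfree s w : fully_commutative s ->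
  wprod w = s -> size w = coxlen s -> braidfree w.
Proof.
move=> fc E sz w' C u z i; split=> [Ew | k Fk ne Ew].
  have : coxlen s <= size (u ++ z).
    by rewrite -E (wprod_ceq C) Ew wprod_double coxlen_le.
  by rewrite -sz (ceq_size C) Ew !size_cat /=; lia.
have C2 : ceq w (u ++ [:: k, i, k & z]).
  apply: (fc_ceq fc) => //; first by rewrite -wprod_braid // -Ew -(wprod_ceq C).
  by rewrite -sz (ceq_size C) Ew !size_cat.
have := ceq_count i (ceq_trans (ceq_sym C) C2).
by rewrite Ew !count_cat /= eqxx [k == i]eq_sym (negPf ne); lia.
Qed.

(** If at most one letter of [v] is not far from [i], the others commute out of the way and leave
    [i i] or [i k i]. *)
Lemma braidfree_between w u i v z : braidfree w ->
    w = u ++ i :: v ++ i :: z -> i \notin v ->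
  1 < count (fun k => ~~ far i k) v.
Proof.
move=> bf Ew iv; rewrite ltnNge; apply/negP; rewrite leq_eqVlt => /orP[]; last first.
  rewrite ltnS leqn0 -leqn0 leqNgt -has_count => /hasPn Fv.
  have [] := bf (u ++ [:: i, i & v ++ z]) _ u (v ++ z) i; last by [].
  rewrite Ew; have := @ceq_move_front n v z i (fun k kv => negbNE (Fv k kv)).
  by move/(ceq_cons i)/(ceq_cat u [::]); rewrite !cats0.
move=> /eqP c1; have /hasP[k kv Fk] : has (fun k => ~~ far i k) v by rewrite has_count c1.
case: (splitPr kv) Ew iv c1 => v1 v2 Ew; rewrite mem_cat inE !negb_or.
case/and3P=> _ ne _; rewrite count_cat /= Fk => c1.
have Fv1 l : l \in v1 -> far i l.
  move=> lv; apply/negPn/negP=> Fl.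
  suff : has (fun k => ~~ far i k) v1 by rewrite has_count; lia.
  by apply/hasP; exists l.
have Fv2 l : l \in v2 -> far i l.
  move=> lv; apply/negPn/negP=> Fl.
  suff : has (fun k => ~~ far i k) v2 by rewrite has_count; lia.
  by apply/hasP; exists l.
have C1 : ceq w (u ++ i :: v1 ++ k :: i :: v2 ++ z).
  rewrite Ew; have /(ceq_cat (u ++ i :: v1 ++ [:: k]) [::]) := @ceq_move_front n v2 z i Fv2.
  by rewrite !cats0 -!catA /= -!catA.
have C2 : ceq (u ++ i :: v1 ++ k :: i :: v2 ++ z) ((u ++ v1) ++ [:: i, k, i & v2 ++ z]).
  have := ceq_sym (@ceq_move_front n v1 (k :: i :: v2 ++ z) i Fv1).
  by move/(ceq_cat u [::]); rewrite !cats0 -!catA.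
by have [_ /(_ k Fk ne)] := bf _ (ceq_trans C1 C2) (u ++ v1) (v2 ++ z) i.
Qed.

(* [up] and [dn] are the two directions along the path. If a letter i had no
   neighbour on the [dn] side between two occurrences, then its [up] neighbour
   k would occur twice there without any i in between; iterate. *)
Lemma braidfree_dir w (up dn : rel 'I_n) (rk : 'I_n -> nat) :
    (forall i k, ~~ far i k -> [|| i == k, up i k | dn i k]) ->
    (forall i k k', up i k -> up i k' -> k = k') ->
    (forall i k l, up i k -> dn k l -> l = i) ->
    (forall i k, up i k -> rk k < rk i) ->
    braidfree w ->
  forall u i v z, w = u ++ i :: v ++ i :: z -> has (dn i) v.
Proof.
move=> nbr up_inj updn rk_lt bf u i; move: {2}(rk i).+1 (ltnSn (rk i)) => N.
elim: N u i => // N IH u i rkN v z.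
wlog iv : v z / i \notin v.
  move=> W; have [iv|] := boolP (i \in v); last exact: W.
  have [v1 [v2 [-> iv1]]] := split_first iv; rewrite -catA /= => /(W _ _ iv1).
  by rewrite has_cat => ->.
move=> Ew; apply/negPn/negP => /hasPn nd.
have := braidfree_between bf Ew iv; rewrite -size_filter.
case Ef: (filter _ v) => [|k [|k' f]] // _.
have mem_f l : l \in k :: k' :: f -> up i l.
  rewrite -Ef mem_filter => /andP[/nbr /or3P[/eqP <-|//|dl] lv].
    by rewrite lv in iv.
  by have := nd l lv; rewrite dl.
have upk : up i k by rewrite mem_f ?mem_head.
have Ek : k = k' by apply: (up_inj i) => //; rewrite mem_f // !inE eqxx orbT.
have kv : k \in v by move: (mem_head k (k' :: f)); rewrite -Ef mem_filter => /andP[].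
have [v1 [v2 [Ev kv1]]] := split_first kv.
have kv2 : k \in v2.
  have : 1 < count_mem k v.
    apply: leq_trans (_ : count_mem k (filter (fun k => ~~ far i k) v) <= _).
      by rewrite Ef /= -Ek eqxx.
    by rewrite count_filter; apply: sub_count => x /= /andP[].
  move=> c2; apply/negPn/negP => /count_memPn c0; move: c2.
  by rewrite Ev count_cat /= eqxx (count_memPn kv1) c0.
have [v3 [v4 [Ev2 _]]] := split_first kv2.
(* Between the two letters [k] the induction hypothesis gives a letter on the [dn] side of [k]; this
   is [i], which does not occur in [v]. *)
have := IH (u ++ i :: v1) k _ v3 (v4 ++ i :: z).
rewrite Ew Ev Ev2 -!catA /= -!catA /= => /(_ _ erefl).
have lt_k : rk k < N by apply: leq_trans (rk_lt i k upk) _; rewrite -ltnS.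
move/(_ lt_k) => /hasP[l lv3 /(updn i k l upk) El].
by case/negP: iv; rewrite -El Ev Ev2 mem_cat inE mem_cat lv3 !orbT.
Qed.

Lemma pre_shift b i w :
    (forall v z, w = v ++ i :: z -> has (fun k => k.+1 == b) v) ->
  pre b i.+1 (shift w).
Proof.
elim: w => //= k w IH A; case: eqP => //= nk.
have ne : k != i.
  by apply/eqP=> E; have := A [::] w; rewrite E /= => /(_ erefl).
rewrite eqSS (inj_eq val_inj) ne /=; apply: IH => v z E.
by have := A (k :: v) z; rewrite E /= => /(_ erefl) /orP[/eqP|].
Qed.

(** [braidfree_dir] is used in both directions, [rk] measuring the distance to the end of the path
    that [up] leads to. *)
Lemma braidfree_good w : braidfree w -> good (shift w).
Proof.
move=> bf.
have up u i v z : w = u ++ i :: v ++ i :: z -> has (fun k => k.+1 == i.+2) v.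
  apply: (@braidfree_dir w (fun i k => k.+1 == i) (fun i k => k.+1 == i.+2) val) => //.
  - by move=> j k /nonfarP[->|E|E]; rewrite ?eqxx // E eqxx ?orbT.
  - by move=> j k k' /eqP E /eqP E'; apply: val_inj => /=; lia.
  - by move=> j k l /eqP E /eqP E'; apply: val_inj => /=; lia.
  - by move=> j k /= /eqP <-.
have dn u i v z : w = u ++ i :: v ++ i :: z -> has (fun k => k.+1 == i) v.
  apply: (@braidfree_dir w (fun i k => k == i.+1 :> nat) (fun i k => k.+1 == i) 
           (fun i => n - i)) => //.
  - by move=> j k /nonfarP[->|E|E]; rewrite ?eqxx // E eqxx ?orbT.
  - by move=> j k k' /eqP E /eqP E'; apply: val_inj => /=; lia.
  - by move=> j k l /eqP E /eqP E'; apply: val_inj => /=; lia.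
  - by move=> j k /= /eqP E; have := ltn_ord k; lia.
have: forall v i v' z, w = v ++ i :: v' ++ i :: z ->
    has (fun k => k.+1 == i.+2) v' /\ has (fun k => k.+1 == i) v'.
  by move=> u i v z E; split; [apply: up E | apply: dn E].
elim: w {bf up dn} => //= i w IH A; apply/and3P; split.
- by apply: pre_shift => v z E; have [] := A [::] i v z; rewrite ?E.
- by apply: pre_shift => v z E; have [] := A [::] i v z; rewrite ?E.
- by apply: IH => v k v' z E; apply: (A (i :: v) k v' z); rewrite E.
Qed.

Lemma sorted_neq_nseq (T : eqType) (x : T) m :
  sorted [rel a b | a != b] (nseq m x) = (m <= 1).
Proof. by case: m => [|[|m]] //=; rewrite eqxx. Qed.

Lemma filter_shift_nseq w x y : (forall i, i.+1 != x) ->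
  [seq a <- shift w | (a == x) || (a == y)] =
  nseq (count (fun i => i.+1 == y) w) y.
Proof.
move=> nx; elim: w => //= i w IH; rewrite (negPf (nx i)) /= IH.
by case: eqP => [->|].
Qed.

Lemma head_cvec w : head 0 (cvec w) = count (fun i : 'I_n => i.+1 == 1) w.
Proof.
case: n w => [|n'] w; first by case: w => [|[]] //; rewrite /cvec enum_ord0.
by rewrite -nth0 (nth_cvec w ord0); apply: eq_count => i /=.
Qed.

Lemma good_shiftP w :
  good (shift w) <-> [/\ altword w, head 0 (cvec w) <= 1 & last 0 (cvec w) <= 1].
Proof.
have fE i j : j = i.+1 :> nat ->
    [seq a <- shift w | (a == i.+1) || (a == i.+2)] = shift (proj i j w).
  move=> E; rewrite /shift filter_map; congr map; apply: eq_filter => a /=.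
  by rewrite -[a == j]val_eqE /= E !eqSS.
have mE (u : seq 'I_n) : sorted [rel a b | a != b] (shift u) =
    sorted [rel a b | a != b] u.
  by rewrite sorted_map; case: u => //= a u; apply: eq_path.
rewrite head_cvec last_cvec; split=> [/goodP A | [A h l]].
  split=> [i j E | |].
  - by have := A i.+1; rewrite (fE i j E) mE.
  - by have := A 0; rewrite filter_shift_nseq // sorted_neq_nseq.
  - have := A n; under eq_filter do rewrite orbC.
    rewrite filter_shift_nseq ?sorted_neq_nseq // => i.
    by have := ltn_ord i; lia.
apply/goodP=> -[|x]; first by rewrite filter_shift_nseq // sorted_neq_nseq.
have [lt_x | ge_x] := ltnP x.+1 n.
  by rewrite (fE (Ordinal (ltnW lt_x)) (Ordinal lt_x)) // mE; apply: A.
under eq_filter do rewrite orbC.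
rewrite filter_shift_nseq => [|i]; last by have := ltn_ord i; lia.
rewrite sorted_neq_nseq; move: ge_x; rewrite leq_eqVlt => /predU1P[<- //|lt_n].
rewrite (_ : count _ _ = 0) //; apply/eqP; rewrite -leqn0 leqNgt -has_count.
by apply/hasPn => i _; have := ltn_ord i; lia.
Qed.

(** For fully commutative [s] the vector is independent of the chosen reduced word, since
    commutations keep the counts. *)
Definition rvec s : seq nat :=
  cvec (projT1 (cid (coxlen_word s))).

Lemma sumn_rvec s : sumn (rvec s) = coxlen s.
Proof. by rewrite sumn_cvec; case: cid => w []. Qed.

(** For an involution the reversed word is again a reduced word of [s], so full commutativity makes
    it equivalent to [w]. *)
Lemma fc_sdalt s w : fully_commutative s -> (s * s == 1)%g ->
  wprod w = s -> size w = coxlen s -> sdalt w /\ good (shift w).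
Proof.
move=> fc s2 E sz; have gw := braidfree_good (fc_braidfree fc E sz).
split=> //; apply/sdaltP; split; first by have [] := (good_shiftP w).1 gw.
apply: (fc_ceq fc) => //; last by rewrite size_rev.
by rewrite wprod_rev E; apply/eqP; rewrite eq_invg_mul.
Qed.

(** The counts determine the class and hence the product. Conversely a self-dual word with the given
    counts is good, so it is reduced with fully commutative product, and self-duality makes the
    product an involution. *)
Lemma perm_rvec l : uniq l ->
    (forall u : seq nat, (u \in l) =
       [&& size u == n, sorted hstep u, head 0 u <= 1 & last 0 u <= 1]) ->
  perm_eq [seq rvec s | s in [pred s | fully_commutative s && (s * s == 1)%g]] l.
Proof.
move=> Ul lE; apply: perm_eq_image => // [s1 s2 | u].
  rewrite !inE /rvec => /andP[fc1 i1] /andP[fc2 i2].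
  case: cid => w1 /= [E1 sz1]; case: cid => w2 /= [E2 sz2] /eq_cvecP C.
  have [S1 _] := fc_sdalt fc1 i1 E1 sz1; have [S2 _] := fc_sdalt fc2 i2 E2 sz2.
  by rewrite -E1 -E2; apply: wprod_ceq; apply: sdalt_ceq.
rewrite lE; split=> [/and4P[/eqP sz st h t] | [s]]; last first.
  rewrite inE /rvec => /andP[fc i] <-; case: cid => w /= [E sz].
  have [S /good_shiftP[_ -> ->]] := fc_sdalt fc i E sz.
  by rewrite size_cvec eqxx sdalt_sorted.
have [w [A Cw]] := sdalt_of_cvec sz st; have [A1 A2] := (sdaltP w).1 A.
have gw : good (shift w) by apply/good_shiftP; rewrite Cw.
have fc := good_fully_commutative gw; exists (wprod w).
  by rewrite inE fc -eq_invg_mul -wprod_rev -(wprod_ceq A2) eqxx.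
rewrite /rvec; case: cid => w' /= [E' sz']; rewrite -Cw; apply/eq_cvecP => i.
by apply: ceq_count; apply: (fc_ceq fc) => //; rewrite coxlen_good.
Qed.

End FullyCommutative.

(** * Walks *)

(** The start [h] is not recorded. Since [0.-1 = 0], the downward step at height 0 is the level
    step. *)
Fixpoint walks (j h : nat) : seq (seq nat) :=
  if j is j'.+1 then
    [seq h.+1 :: t | t <- walks j' h.+1] ++ [seq h.-1 :: t | t <- walks j' h.-1]
  else [:: [::]].

Lemma mem_walks j h t : (t \in walks j h) = (size t == j) && path hstep h t.
Proof.
elim: j h t => [|j IH] h t /=; first by rewrite inE; case: t.
rewrite mem_cat; case: t => [|b t] /=.
  by apply/negP=> /orP[] /mapP[].
rewrite eqSS /hstep; apply/orP/idP => [[] /mapP[t' + [-> ->]]|].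
- by rewrite IH eqxx => /andP[-> ->].
- by rewrite IH eqxx orbT => /andP[-> ->].
case/and3P=> sz /orP[]/eqP -> pt; [left | right]; apply: map_f;
  by rewrite IH sz.
Qed.

Lemma uniq_walks j h : uniq (walks j h).
Proof.
elim: j h => // j IH h /=; rewrite cat_uniq !map_inj_uniq ?IH //=; last 2 first.
- by move=> ? ? [].
- by move=> ? ? [].
rewrite andbT; apply/hasPn => u /mapP[t _ ->]; apply/mapP => -[t' _ []]; lia.
Qed.

(** A virtual column of size 0 before the first one expresses the end condition, since the step from
    0 leads to 0 or 1. *)
Lemma path_hstep0 u : path hstep 0 u = sorted hstep u && (head 0 u <= 1).
Proof. by case: u => //= a u; rewrite andbC /hstep; congr (_ && _); lia. Qed.

Lemma head_le_last h t : path hstep h t -> h <= last h t + size t.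
Proof.
elim: t h => [|b t IH] h /=; first by rewrite addn0.
by rewrite /hstep => /andP[hb /IH]; lia.
Qed.

Lemma path_hstep_rev u :
  path hstep 0 (rev u) = sorted hstep u && (last 0 u <= 1).
Proof.
rewrite path_hstep0 rev_sorted (_ : head 0 (rev u) = last 0 u); last first.
  by case/lastP: u => // u x; rewrite rev_rcons last_rcons.
by congr (_ && _); case: u => //= a u; apply: eq_path => b c; apply: hstep_sym.
Qed.

(* A walk of j steps from h records the sizes of j + 1 columns. *)
Definition starts M j := [seq h :: t | h <- iota 0 M, t <- walks j h].

Lemma mem_starts M j u :
  (u \in starts M j) = [&& size u == j.+1, sorted hstep u & head 0 u < M].
Proof.
apply/allpairsPdep/idP => [[h [t [hM tw ->]]]|].
  by move: hM tw; rewrite mem_iota mem_walks /= eqSS => -> /andP[-> ->].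
case: u => // h t /= /and3P[sz pt hM]; exists h, t; split=> //.
  by rewrite mem_iota.
by rewrite mem_walks -eqSS sz.
Qed.

Lemma uniq_starts M j : uniq (starts M j).
Proof.
apply: allpairs_uniq_dep => [|h _|]; first exact: iota_uniq.
  exact: uniq_walks.
by move=> [h t] [h' t'] _ _ /= [-> ->].
Qed.

Import GRing.Theory.
Local Open Scope ring_scope.

(** * Power series in q *)

Section FpsCoef.
Variable R : comNzRingType.
Implicit Types f g : fps R.

Lemma fcoef_sum (I : Type) (r : seq I) (P : pred I) (F : I -> fps R) m :
  fcoef (\sum_(i <- r | P i) F i) m = \sum_(i <- r | P i) fcoef (F i) m.
Proof. exact: (big_morph (fun f => fcoef f m)). Qed.

Lemma fcoefM f g m :
  fcoef (f * g) m = \sum_(i < m.+1) fcoef f i * fcoef g (m - i).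
Proof. by []. Qed.

Lemma fcoefXM f m :
  fcoef (fpsX * f) m = if m is m'.+1 then fcoef f m' else 0.
Proof.
rewrite fcoefM; case: m => [|m]; first by rewrite big_ord1 mul0r.
rewrite big_ord_recl mul0r add0r big_ord_recl mul1r big1 ?addr0 => [|i _].
  by rewrite subSS subn0.
by rewrite mul0r.
Qed.

Lemma fcoefXnM f k m :
  fcoef (fpsX ^+ k * f) m = if (k <= m)%N then fcoef f (m - k) else 0.
Proof.
elim: k m => [|k IH] m; first by rewrite mul1r subn0.
by rewrite exprS -mulrA fcoefXM; case: m => // m; rewrite IH ltnS subSS.
Qed.

Lemma fcoefXn k m : fcoef (fpsX ^+ k : fps R) m = (m == k)%:R.
Proof.
rewrite -[fpsX ^+ k]mulr1 fcoefXnM; case: leqP => [le_km|lt_mk] /=.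
  by rewrite subn_eq0 eqn_leq le_km andbT.
by rewrite (ltn_eqF lt_mk).
Qed.

(** The first series is the sum of all [F h], finite in each coefficient because [F h] has order at
    least [h]. From [M] on the terms are geometric with ratio [fpsX ^+ k]. *)
Lemma fps_geometric_tail (F : nat -> fps R) k M :
    (forall h m, (m < h)%N -> fcoef (F h) m = 0) ->
    (forall h, (M <= h)%N -> F h.+1 = fpsX ^+ k * F h) ->
  (1 - fpsX ^+ k) * (Fps (fun m => \sum_(h < m.+1) fcoef (F h) m)
                     - \sum_(h < M) F h) = F M.
Proof.
move=> F0 FS; set L := Fps _; set T := L - _.
(* Every window of more than [m] heights from [M] on gives the same coefficient, so the windows for
   [T] and its multiple can be matched and telescoped. *)
have TE m N : (m < N)%N -> fcoef T m = \sum_(M <= h < M + N) fcoef (F h) m.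
  move=> lt_mN; rewrite /T /= fcoef_sum -(big_mkord xpredT (fun h => fcoef (F h) m)).
  rewrite -[\sum_(i < M) _](big_mkord xpredT (fun h => fcoef (F h) m)).
  have ext K : (m < K)%N -> \sum_(0 <= h < m.+1) fcoef (F h) m =
      \sum_(0 <= h < K) fcoef (F h) m.
    move=> lt_mK; rewrite (@big_cat_nat _ _ _ m.+1 0 K) //=.
    rewrite [X in _ + X]big_nat_cond [X in _ + X]big1 ?addr0 // => h.
    by rewrite andbT => /andP[lt_mh _]; apply: F0.
  rewrite (ext (M + N)%N); last by rewrite ltn_addl.
  by rewrite (@big_cat_nat _ _ _ M 0 (M + N)) ?leq_addr //= addrAC subrr add0r.
apply/fpsP => m; rewrite mulrBl mul1r.
have -> : fcoef (T - fpsX ^+ k * T) m = fcoef T m - fcoef (fpsX ^+ k * T) m by [].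
have -> : fcoef (fpsX ^+ k * T) m = \sum_(M <= h < M + m.+1) fcoef (F h.+1) m.
  rewrite fcoefXnM; under eq_big_nat => h /andP[le_Mh _].
    rewrite FS // fcoefXnM; over.
  case: leqP => _; last by rewrite big1.
  by apply: TE; rewrite ltnS leq_subr.
rewrite (TE m m.+1) // -sumrB.
under eq_bigr do rewrite -opprB.
rewrite sumrN telescope_sumr ?leq_addr // opprB.
by rewrite (F0 (M + m.+1)%N) ?subr0 // ltn_addl.
Qed.

End FpsCoef.

Lemma q_neq0 : q != 0.
Proof.
rewrite /q tofrac_eq0; apply/eqP => /fpsP/(_ 1%N) /eqP.
by rewrite /= oner_eq0.
Qed.

Lemma qexpE k : q ^+ k = tofrac (fpsX ^+ k).
Proof. by rewrite rmorphXn. Qed.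

Lemma one_sub_qexp_neq0 k : 1 - q ^+ k.+1 != 0.
Proof.
rewrite qexpE -[1]tofrac1 -tofracB tofrac_eq0; apply/eqP => /fpsP/(_ 0%N) /=.
by rewrite fcoefXn subr0 => /eqP; rewrite oner_eq0.
Qed.

Lemma tofrac_count (T : Type) (l : seq T) (f : T -> nat) :
  tofrac (Fps (fun m => (count (fun t => f t == m) l)%:R) : fps rat) =
  \sum_(t <- l) q ^+ f t.
Proof.
under eq_bigr do rewrite qexpE.
rewrite -rmorph_sum /=; congr tofrac.
apply/fpsP => m /=; rewrite fcoef_sum; under eq_bigr do rewrite fcoefXn eq_sym.
elim: l => [|t l IH] /=; first by rewrite big_nil.
by rewrite big_cons natrD IH.
Qed.

(** * The linear system *)

Section Telescope.
Variables (K : comNzRingType) (a : K) (c D G : nat -> nat -> K).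
Hypothesis cS : forall k h, c k.+1 h = D k h.+2 + D k h.
Hypothesis DS : forall k h, D k h.+1 = c k h * a ^+ h.
Hypothesis GS : forall j h, G j.+1 h = a ^+ h * (G j h.+1 + G j h.-1).

(** Summation by parts: the recursions of [c] and [G] are adjoint, so interior terms cancel and only
    those at the barrier and at the cut-off [M] remain. *)
Lemma pairing_step M k j :
  \sum_(h < M) c k.+1 h * G j h - \sum_(h < M) c k h * G j.+1 h =
  (D k 0 - D k 1) * G j 0 + (D k M.+1 * G j M.-1 - D k M * G j M).
Proof.
(* At [M = 0] barrier and cut-off terms cancel because [0.-1 = 0]. *)
elim: M => [|M IH]; first by rewrite !big_ord0 /=; ring.
rewrite !big_ord_recr /= opprD addrACA IH cS GS mulrA -DS.
by ring.
Qed.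

Lemma pairing_telescope M N :
  \sum_(h < M) c N h * G 0 h - \sum_(h < M) c 0 h * G N h =
  \sum_(k < N) (D k 0 - D k 1) * G (N - k.+1) 0 +
  \sum_(k < N) (D k M.+1 * G (N - k.+1) M.-1 - D k M * G (N - k.+1) M).
Proof.
pose f k := \sum_(h < M) c k h * G (N - k) h.
have -> : \sum_(h < M) c N h * G 0 h - \sum_(h < M) c 0 h * G N h = f N - f 0.
  by rewrite /f subnn subn0.
rewrite -telescope_sumr // big_mkord -big_split /=.
apply: eq_bigr => k _; rewrite -pairing_step /f.
by rewrite -[(N - k)%N]prednK ?subn_gt0 // -subnS.
Qed.

End Telescope.

(** * Walk series by number of steps and starting height *)

Definition wgf (E : pred nat) j h : laurent :=
  \sum_(t <- walks j h | E (last h t)) q ^+ (h + sumn t).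

Lemma wgf0 E h : wgf E 0 h = (E h)%:R * q ^+ h.
Proof.
rewrite /wgf big_mkcond big_seq1 /= addn0.
by case: (E h); rewrite ?mul1r ?mul0r.
Qed.

Lemma wgfS E j h : wgf E j.+1 h = q ^+ h * (wgf E j h.+1 + wgf E j h.-1).
Proof.
rewrite /wgf /= big_cat !big_map mulrDr !big_distrr /=.
by congr (_ + _); apply: eq_bigr => t _; rewrite exprD.
Qed.

Lemma wgf_high j h : (j.+1 < h)%N -> wgf (leq^~ 1%N) j h = 0.
Proof.
elim: j h => [|j IH] h lt_jh; first by rewrite wgf0 leqNgt lt_jh mul0r.
by rewrite wgfS !IH ?addr0 ?mulr0 //; lia.
Qed.

(** * The solution without barrier *)

Section Kernel.
Variables (K : fieldType) (p : K).
Hypothesis p_neq0 : p != 0.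

(* The coefficient of x^(k+1) in the paper's S(x p^h): the generating function
   of the walks from height h - 1 when the heights may become negative. *)
Definition dS k h : K :=
  p ^+ (h * k.+1) * (p ^- 'C(k.+2, 2) * qpoch (- p ^+ 2) (p ^+ 2) k).

Lemma dSh k h : dS k h.+1 = p ^+ k.+1 * dS k h.
Proof. by rewrite /dS mulSn exprD mulrA. Qed.

(** By [dSh] the right side is [dS k h] times a power of [p] and [1 + p ^+ (2 * k.+1)], which is the
    last factor of the longer [qpoch]. *)
Lemma dSS k h : dS k.+1 h.+1 = p ^+ h * (dS k h.+2 + dS k h).
Proof.
rewrite !dSh /dS binS bin1 exprD invfM /qpoch big_ord_recr /= mulNr opprK.
rewrite -[in X in 1 + X]exprM -exprD -mulnS mul2n -addnn exprD.
rewrite [(h * k.+2)%N]mulnS exprD.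
have := expf_neq0 k.+2 p_neq0; have := expf_neq0 'C(k.+2, 2) p_neq0.
move: (p ^+ k.+2) (p ^+ 'C(k.+2, 2)) => y z y0 z0; field.
by rewrite y0 z0.
Qed.

Lemma dS0 h : dS 0 h.+1 = p ^+ h.
Proof.
by rewrite /dS /qpoch big_ord0 muln1 mulr1 exprS mulrAC divff ?mul1r.
Qed.

(** In [h] the terms are geometric with ratio [p ^+ k.+1]; the closed form plays the role of their
    full sum, and the difference that of the tail from [M]. *)
Lemma dS_geometric k M :
    1 - p ^+ k.+1 != 0 ->
  (1 - p ^+ k.+1) *
    (p ^- 'C(k.+1, 2) * (qpoch (- p ^+ 2) (p ^+ 2) k / (1 - p ^+ k.+1))
     - \sum_(h < M) dS k h.+1) = dS k M.+1.
Proof.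
move=> y1; elim: M => [|M IH]; last first.
  by rewrite big_ord_recr opprD addrA mulrBr IH [in RHS]dSh /=; ring.
rewrite big_ord0 subr0 /dS mul1n (binS k.+1) bin1 exprD invfM.
have := expf_neq0 k.+1 p_neq0; have := expf_neq0 'C(k.+1, 2) p_neq0.
move: y1; move: (p ^+ k.+1) (p ^+ 'C(k.+1, 2)) => y z y1 z0 y0; field.
by rewrite y0 z0 y1.
Qed.

End Kernel.

(** A walk of [j] steps from height at least [j] can reach 0 only at its end, so it never meets the
    barrier. *)
Lemma wgf_low j h : (j <= h)%N -> wgf xpredT j h = dS q j h.+1.
Proof.
elim: j h => [|j IH] h le_jh; first by rewrite wgf0 mul1r (dS0 q_neq0).
rewrite wgfS (dSS q_neq0) !IH ?(leqW (ltnW le_jh)) //; last lia.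
by case: h le_jh.
Qed.

Lemma wgf_telescope (E : pred nat) M N :
  \sum_(h < M) (E h)%:R * dS q N h.+1 - \sum_(h < M) wgf E N h =
  \sum_(k < N) (dS q k 0 - dS q k 1) * wgf E (N - k.+1) 0 +
  \sum_(k < N) (dS q k M.+1 * wgf E (N - k.+1) M.-1 - dS q k M * wgf E (N - k.+1) M).
Proof.
(* This [c] is 1 at [k = 0], so the second sum of the pairing becomes the plain sum of walk
   series. *)
pose c k h := dS q k h.+1 / q ^+ h.
have qh h : q ^+ h != 0 by rewrite expf_neq0 ?q_neq0.
rewrite -(@pairing_telescope _ q c (dS q) (wgf E)).
- congr (_ - _); apply: eq_bigr => h _.
    by rewrite wgf0 /c [in RHS]mulrCA mulfVK.
  by rewrite /c (dS0 q_neq0) divff ?mul1r.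
- by move=> k h; rewrite /c (dSS q_neq0) mulrAC divff ?mul1r.
- by move=> k h; rewrite /c mulfVK.
- exact: wgfS.
Qed.

(** At these heights all walk series are values of [dS] by [wgf_low], and the summand is
    antisymmetric under [k] going to [N - k.+1]. *)
Lemma boundary_sum M N : (N < M)%N ->
  \sum_(k < N) (dS q k M.+1 * wgf xpredT (N - k.+1) M.-1
                - dS q k M * wgf xpredT (N - k.+1) M) = 0.
Proof.
move=> lt_NM; rewrite sumrB.
rewrite [X in _ - X](reindex_inj rev_ord_inj) /= -sumrB big1 // => k _.
rewrite !wgf_low; try lia.
rewrite prednK; last lia.
have -> : (N - (N - k.+1).+1)%N = k by have := ltn_ord k; lia.
by rewrite [X in _ - X]mulrC subrr.
Qed.

(** * Generating functions as sums over walks *)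

Lemma calAE n : fcoef calA n = wgf (leq^~ 1%N) n 0.
Proof.
rewrite /= /fc_invol_gf /wgf.
have := @perm_rvec n [seq u <- walks n 0 | last 0 u <= 1]%N.
rewrite filter_uniq ?uniq_walks // => /(_ isT).
have mE (u : seq nat) : (u \in [seq u <- walks n 0 | last 0 u <= 1])%N =
   [&& size u == n, sorted hstep u, head 0 u <= 1 & last 0 u <= 1]%N.
  by rewrite mem_filter mem_walks path_hstep0 andbC -!andbA.
move/(_ mE) => P; rewrite -[in RHS]big_filter -(perm_big _ P) big_map big_enum /=.
by apply: eq_bigr => s _; rewrite add0n sumn_rvec.
Qed.

Lemma mem_rev_walks n u : (u \in map rev (walks n 0)) =
  [&& size u == n, sorted hstep u & last 0 u <= 1]%N.
Proof.
by rewrite -{1}(revK u) mem_map ?mem_walks ?size_rev ?path_hstep_rev //;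
  apply: (can_inj revK).
Qed.

Lemma uniq_rev_walks n : uniq (map rev (walks n 0)).
Proof. by rewrite map_inj_uniq ?uniq_walks //; apply: (can_inj revK). Qed.

Lemma calBaE n : fcoef calBa n = \sum_(u <- map rev (walks n 0)) q ^+ sumn u.
Proof.
rewrite /= -tofrac_count; congr tofrac; apply/fpsP => m /=; congr (_%:R).
rewrite -size_filter; apply: (@card_sd_alt _ _ _ (fun u => last 0 u <= 1)%N) => [H t HH tH||u].
- exact: (last_le1_cvec HH tH).
- by rewrite filter_uniq ?uniq_rev_walks.
- by rewrite mem_filter mem_rev_walks andbC -!andbA.
Qed.

Lemma calBa_wgf n : fcoef calBa n = wgf xpredT n 0.
Proof. by rewrite calBaE big_map; apply: eq_bigr => u _; rewrite sumn_rev. Qed.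

Lemma sum_starts (E : pred nat) M j :
  \sum_(h < M) wgf E j h = \sum_(u <- starts M j | E (last 0%N u)) q ^+ sumn u.
Proof.
rewrite [RHS]big_mkcond big_allpairs_dep /= -(big_mkord xpredT (wgf E j)).
by rewrite /index_iota subn0; apply: eq_bigr => h _; rewrite -big_mkcond.
Qed.

(** Here the columns are read from the first, in [calBa_wgf] from the last. A walk of [N] steps
    ending at height at most 1 starts at most at [N.+1], so the bound [N.+3] loses nothing. *)
Lemma calBa_starts N :
  fcoef calBa N.+1 = \sum_(h < N.+3) wgf (leq^~ 1%N) N h.
Proof.
rewrite calBaE sum_starts -[in RHS]big_filter; apply: perm_big.
apply: uniq_perm; rewrite ?uniq_rev_walks ?filter_uniq ?uniq_starts // => u.
rewrite mem_rev_walks mem_filter mem_starts.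
case: (eqVneq (size u)) => sz; rewrite ?andbF //=.
case: (boolP (sorted _ _)) => st; rewrite ?andbF //=.
case: (boolP (_ <= 1)%N) => // le1.
by case: u sz st le1 => //= h t [sz] /head_le_last; lia.
Qed.

Lemma sd_alt_gfE N : sd_alt_gf N.+1 =
  Fps (fun m => \sum_(h < m.+1)
         fcoef (\sum_(t <- walks N h) fpsX ^+ (h + sumn t)) m).
Proof.
apply/fpsP => m /=.
transitivity ((count (fun u => sumn u == m) (starts m.+1 N))%:R : rat).
  congr (_%:R); rewrite -size_filter.
  rewrite -(@card_sd_alt N.+1 m xpredT xpredT) => [||| u] //.
  - by apply: eq_card => H; rewrite !inE andbT.
  - by rewrite filter_uniq ?uniq_starts.
  rewrite mem_filter mem_starts; case: (eqVneq (sumn u)) => Eu /=; rewrite ?andbF //.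
  case: (eqVneq (size u)) => //= sz; case: (sorted _ _) => //=.
  by case: u sz Eu => //= h t _ <-; lia.
rewrite -sum1_count natr_sum [LHS]big_mkcond big_allpairs_dep /=.
rewrite -(big_mkord xpredT
  (fun h => fcoef (\sum_(t <- walks N h) fpsX ^+ (h + sumn t)) m)).
rewrite /index_iota subn0; apply: eq_bigr => h _; rewrite fcoef_sum.
by apply: eq_bigr => t _; rewrite fcoefXn eq_sym; case: eqP.
Qed.

(** From height [N] on the series are free of the barrier, hence geometric with ratio
    [q ^+ N.+1]. *)
Lemma calL_tail N M : (N <= M)%N ->
  (1 - q ^+ N.+1) * (fcoef calL N.+1 - \sum_(h < M) wgf xpredT N h) = dS q N M.+1.
Proof.
move=> le_NM; pose F h : fps rat := \sum_(t <- walks N h) fpsX ^+ (h + sumn t).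
have FE h : tofrac (F h) = wgf xpredT N h.
  by rewrite /F rmorph_sum; apply: eq_bigr => t _; rewrite qexpE.
have F0 h m : (m < h)%N -> fcoef (F h) m = 0.
  by move=> lt_mh; rewrite fcoef_sum big1 // => t _; rewrite fcoefXn; case: eqP => //; lia.
have FS h : (M <= h)%N -> F h.+1 = fpsX ^+ N.+1 * F h.
  move=> le_Mh; apply/eqP; rewrite -tofrac_eq tofracM !FE !wgf_low; try lia.
  by rewrite dSh qexpE.
have := fps_geometric_tail F0 FS; rewrite -sd_alt_gfE.
move/(congr1 (@tofrac _)); rewrite tofracM !tofracB tofrac1 -qexpE rmorph_sum FE.
rewrite wgf_low // => <-; congr (_ * (_ - _)).
by apply: eq_bigr => h _; rewrite -FE.
Qed.

Lemma calN_tail N M :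
  (1 - q ^+ N.+1) * (fcoef calN N.+1 - \sum_(h < M) dS q N h.+1) = dS q N M.+1.
Proof. exact: (dS_geometric q_neq0 M (one_sub_qexp_neq0 N)). Qed.

Lemma fcoef_kernel (B : fps laurent) N :
  fcoef (fpsX * (calS - fps_dil q calS) * B) N.+1 =
  \sum_(k < N) (dS q k 0 - dS q k 1) * fcoef B (N - k.+1).
Proof.
rewrite -mulrA fcoefXM fcoefM big_ord_recl /=.
rewrite mulr0 subrr mul0r add0r; apply: eq_bigr => k _.
by rewrite /dS mul0n mul1n expr0 mul1r.
Qed.

(** * Comparison of coefficients *)

Theorem theorem6p5 :
  [/\ calS = fps_dil q^-1 calN - calN,
      calBa = 1 + fps_dil q calS + fps_dil (q ^+ 2) calS
              - fpsX * (calS - fps_dil q calS) * calA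
    & calL = calN - fpsX * (calS - fps_dil q calS) * calBa].
Proof.
split; apply/fpsP => -[|N].
- by rewrite /= mulr0 subrr.
(* At [M = 0] the tail is the whole sum, which is the identity with [x] replaced by [x q]. *)
- have := calN_tail N 0; rewrite big_ord0 subr0 /dS mul1n => E.
  apply: (mulfI (expf_neq0 N.+1 q_neq0)); rewrite -E.
  have -> : fcoef (fps_dil q^-1 calN - calN) N.+1 =
     q^-1 ^+ N.+1 * fcoef calN N.+1 - fcoef calN N.+1 by [].
  rewrite exprVn; have := expf_neq0 N.+1 q_neq0.
  by move=> y0; rewrite mulrBr mulVKf // mulrBl mul1r.
- rewrite calBa_wgf wgf0 -mulrA.
  have -> f g h k : fcoef (f + g + h - fpsX * k : fps laurent) 0 =
     fcoef f 0 + fcoef g 0 + fcoef h 0 - fcoef (fpsX * k) 0 by [].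
  by rewrite fcoefXM /= !mulr0 !addr0 mul1r subr0.
- have -> f g h k : fcoef (f + g + h - k : fps laurent) N.+1 =
     fcoef f N.+1 + fcoef g N.+1 + fcoef h N.+1 - fcoef k N.+1 by [].
  rewrite fcoef_kernel calBa_starts.
  under [X in _ = _ - X]eq_bigr do rewrite calAE.
  (* At this cut-off the remaining steps are too few to come down to height 1, so the boundary terms
     vanish. *)
  have := wgf_telescope (leq^~ 1%N) N.+3 N.
  rewrite [X in _ = _ + X]big1 => [|k _]; last first.
    by rewrite !wgf_high ?mulr0 ?subrr //=; lia.
  rewrite addr0 => <-.
  (* The two allowed end heights give the terms [S(xq)] and [S(xq^2)]. *)
  have -> : \sum_(h < N.+3) (h <= 1)%:R%R * dS q N h.+1 = dS q N 1 + dS q N 2.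
    rewrite 2!big_ord_recl big1 => [|k _]; last by rewrite mul0r.
    by rewrite addr0 !mul1r.
  have -> : fcoef (1 : fps laurent) N.+1 = 0 by [].
  rewrite add0r opprB.
  have <- : dS q N 1 = fcoef (fps_dil q calS) N.+1 by rewrite /dS mul1n.
  have <- : dS q N 2 = fcoef (fps_dil (q ^+ 2) calS) N.+1.
    by rewrite /dS exprM.
  by rewrite addrC subrK.
- rewrite -mulrA.
  have -> f k : fcoef (f - fpsX * k : fps laurent) 0 =
     fcoef f 0 - fcoef (fpsX * k) 0 by [].
  by rewrite fcoefXM subr0.
- have -> f k : fcoef (f - k : fps laurent) N.+1 =
     fcoef f N.+1 - fcoef k N.+1 by [].
  rewrite fcoef_kernel.
  under [X in _ = _ - X]eq_bigr do rewrite calBa_wgf.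
  have := wgf_telescope xpredT N.+1 N; rewrite boundary_sum // addr0 => <-.
  under [X in _ - (X - _)]eq_bigr do rewrite mul1r.
  (* The coefficients of [calL] and [calN] exceed their partial sums up to [N.+1] by the same
     tail. *)
  apply: (mulfI (one_sub_qexp_neq0 N)).
  have TL := @calL_tail N N.+1 (leqnSn N); have TN := calN_tail N N.+1.
  move: TL; rewrite -TN mulrBr => /eqP; rewrite subr_eq => /eqP ->.
  by rewrite -mulrDr opprB addrAC addrA.
Qed.
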